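(* The following linear maps, where each pair (product, coproduct) stands for $\langle\mathcal G\rangle_{\mathbb Q}$ with the corresponding Hopf algebra structure, are Hopf algebra isomorphisms: (i) $\Phi_{\mathrm{regmono}\leftarrow\mathrm{mono}}:(\cdot_{\mathrm{mono}},\Delta_{\mathrm{hom}'})\to(\cdot_{\mathrm{regmono}},\Delta_{\mathrm{hom}'})$; (ii) $\Phi_{\mathrm{mono}\leftarrow\mathrm{hom}}:(\cdot_{\mathrm{hom}},\Delta_{\mathrm{hom}'})\to(\cdot_{\mathrm{mono}},\Delta_{\mathrm{hom}'})$; (iii) $\Phi_{\mathrm{regmono}\leftarrow\mathrm{hom}}:(\cdot_{\mathrm{hom}},\Delta_{\mathrm{hom}'})\to(\cdot_{\mathrm{regmono}},\Delta_{\mathrm{hom}'})$; (iv) $\Phi_{\mathrm{hom}'\leftarrow\mathrm{hom}}:(\cdot_{\mathrm{hom}},\Delta_{\mathrm{hom}'})\to(\cdot_{\mathrm{hom}'},\Delta_{\mathrm{hom}})$; (v) $\Phi_{\mathrm{mono}'\leftarrow\mathrm{mono}}:(\cdot_{\mathrm{mono}},\Delta_{\mathrm{hom}'})\to(\cdot_{\mathrm{mono}'},\Delta_{\mathrm{hom}})$; (vi) $\Phi_{\mathrm{regmono}'\leftarrow\mathrm{regmono}}:(\cdot_{\mathrm{regmono}},\Delta_{\mathrm{hom}'})\to(\cdot_{\mathrm{regmono}'},\Delta_{\mathrm{hom}})$.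
   Context: Graphs are finite simple graphs (isolated vertices allowed, no loops, no parallel edges); $\mathsf e$ is the empty graph. A graph homomorphism $f:\sigma\to\tau$ is a map $V(\sigma)\to V(\tau)$ sending edges to edges. $\mathrm{Mono}(\sigma,\tau)$ is the set of those injective on vertices (monomorphisms); a regular monomorphism is a homomorphism that is an isomorphism onto the subgraph of $\tau$ induced by $f(V(\sigma))$; $\mathrm{Epi}(\sigma,\tau)$ is the set of homomorphisms surjective on vertices; $\mathrm{RegEpi}(\sigma,\tau)$ those surjective on vertices and on edges. $\mathrm{Aut}(\sigma)$ is the automorphism group. $\mathcal G$ is the set of isomorphism classes of graphs and $\langle\mathcal G\rangle_{\mathbb Q}$ the $\mathbb Q$-vector space with basis $\mathcal G$; $\langle\cdot,\cdot\rangle$ is the bilinear pairing for which $\mathcal G$ (resp. $\mathcal G\times\mathcal G$ for tensors) is orthonormal. For $\sigma_1,\sigma_2,\tau\in\mathcal G$, with $\sqcup$ disjoint union, let $M(\sigma_1,\sigma_2;\tau)$ be the number of $f\in\mathrm{RegEpi}(\sigma_1\sqcup\sigma_2,\tau)$ such that $f|_{\sigma_1},f|_{\sigma_2}$ are monomorphisms, and $R(\sigma_1,\sigma_2;\tau)$ the number of $f\in\mathrm{Epi}(\sigma_1\sqcup\sigma_2,\tau)$ such that $f|_{\sigma_1},f|_{\sigma_2}$ are regular monomorphisms. Operations on $\langle\mathcal G\rangle_{\mathbb Q}$: - $\cdot_{\mathrm{hom}}$: bilinear extension of disjoint union. - $\Delta_{\mathrm{hom}}(\tau)=\sum_{(\tau_1,\tau_2)\in\mathcal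 G^2}\langle\tau,\tau_1\cdot_{\mathrm{hom}}\tau_2\rangle\,\tau_1\otimes\tau_2$. - $\Delta_{\mathrm{hom}'}$: the unital algebra morphism for $\cdot_{\mathrm{hom}}$ with $\Delta_{\mathrm{hom}'}(\tau)=\tau\otimes\mathsf e+\mathsf e\otimes\tau$ for (nonempty) connected $\tau$; dual product $\tau_1\cdot_{\mathrm{hom}'}\tau_2=\sum_{\gamma}\langle\tau_1\otimes\tau_2,\Delta_{\mathrm{hom}'}(\gamma)\rangle\gamma$. - $\tau_1\cdot_{\mathrm{mono}}\tau_2=\sum_{\gamma}\frac{M(\tau_1,\tau_2;\gamma)}{|\mathrm{Aut}(\gamma)|}\gamma$, $\quad\tau_1\cdot_{\mathrm{mono}'}\tau_2=\sum_{\gamma}\frac{M(\tau_1,\tau_2;\gamma)}{|\mathrm{Aut}(\tau_1)||\mathrm{Aut}(\tau_2)|}\gamma$. - $\tau_1\cdot_{\mathrm{regmono}}\tau_2=\sum_{\gamma}\frac{R(\tau_1,\tau_2;\gamma)}{|\mathrm{Aut}(\gamma)|}\gamma$, $\quad\tau_1\cdot_{\mathrm{regmono}'}\tau_2=\sum_{\gamma}\frac{R(\tau_1,\tau_2;\gamma)}{|\mathrm{Aut}(\tau_1)||\mathrm{Aut}(\tau_2)|}\gamma$. - The unit is $u(1)=\mathsf e$; the counit is $\varepsilon(\mathsf e)=1$, $\varepsilon(\tau)=0$ for $\tau\ne\mathsf e$. All the pairs in the claim are Hopf algebras with this unit and counit. Linear maps given on $\tau\in\mathcal G$ (sums over $\sigma\in\mathcal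 G$): $\Phi_{\mathrm{regmono}\leftarrow\mathrm{mono}}(\tau)=\sum_\sigma\frac{|\mathrm{Mono}(\tau,\sigma)\cap\mathrm{Epi}(\tau,\sigma)|}{|\mathrm{Aut}(\sigma)|}\sigma$; $\ \Phi_{\mathrm{mono}\leftarrow\mathrm{hom}}(\tau)=\sum_\sigma\frac{|\mathrm{RegEpi}(\tau,\sigma)|}{|\mathrm{Aut}(\sigma)|}\sigma$; $\ \Phi_{\mathrm{regmono}\leftarrow\mathrm{hom}}(\tau)=\sum_\sigma\frac{|\mathrm{Epi}(\tau,\sigma)|}{|\mathrm{Aut}(\sigma)|}\sigma$; $\ \Phi_{\mathrm{hom}'\leftarrow\mathrm{hom}}(\tau)=\Phi_{\mathrm{mono}'\leftarrow\mathrm{mono}}(\tau)=\Phi_{\mathrm{regmono}'\leftarrow\mathrm{regmono}}(\tau)=|\mathrm{Aut}(\tau)|\,\tau$. *)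

(* Defs.v *)
From HB Require Import structures.
From mathcomp Require Import all_boot all_order all_algebra.
From mathcomp Require Import generic_quotient finmap.
From mathcomp Require Import boolp classical_sets cardinality fsbigop.
From mathcomp.multinomials Require Import monalg.

Set Implicit Arguments.
Unset Strict Implicit.
Unset Printing Implicit Defensive.

Import GRing.Theory.
Local Open Scope ring_scope.
Local Open Scope quotient_scope.

Record sgraph := SGraph {
  vertex :> finType;
  edge : rel vertex;
  edge_sym : symmetric edge;
  edge_irr : irreflexive edge }.
Arguments edge {_} _ _.

Section Morphisms.
Variables (s t : sgraph).
Implicit Types f : {ffun s -> t}.

Definition Hom : {set {ffun s -> t}} :=
  [set f : {ffun s -> t} | [forall x, forall y, edge x y ==> edge (f x) (f y)]].

Definition Mono : {set {ffun s -> t}} := [set f in Hom | injectiveb f].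

(** corestricted to the subgraph induced by the image of [f], such a map is
    bijective and preserves and reflects edges *)
Definition RegMono : {set {ffun s -> t}} :=
  [set f in Mono | [forall x, forall y, edge (f x) (f y) ==> edge x y]].

Definition Epi : {set {ffun s -> t}} :=
  [set f in Hom | [forall y, exists x, f x == y]].

Definition RegEpi : {set {ffun s -> t}} :=
  [set f in Epi | [forall y1, forall y2, edge y1 y2 ==>
     [exists x1, exists x2, [&& edge x1 x2, f x1 == y1 & f x2 == y2]]]].

Definition Iso : {set {ffun s -> t}} := RegMono :&: Epi.

Definition isomorphic : bool := Iso != finset.set0.
End Morphisms.

Definition Aut (s : sgraph) : {set {ffun s -> s}} := Iso s s.

Section Constructions.

Definition empty_edge (x y : void) := false.
Fact empty_edge_sym : symmetric empty_edge. Proof. by []. Qed.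
Fact empty_edge_irr : irreflexive empty_edge. Proof. by []. Qed.
Definition empty_sgraph := SGraph empty_edge_sym empty_edge_irr.

Variables (s t : sgraph).

Definition sum_edge (x y : s + t) : bool :=
  match x, y with
  | inl x, inl y => edge x y
  | inr x, inr y => edge x y
  | _, _ => false
  end.
Fact sum_edge_sym : symmetric sum_edge.
Proof. by move=> [x|x] [y|y] //=; apply: edge_sym. Qed.
Fact sum_edge_irr : irreflexive sum_edge.
Proof. by move=> [x|x] /=; apply: edge_irr. Qed.
Definition disjoint_union := SGraph sum_edge_sym sum_edge_irr.

Variable A : {set s}.
Definition induced_edge (x y : {x | x \in A}) := edge (val x) (val y).
Fact induced_edge_sym : symmetric induced_edge.
Proof. by move=> x y; apply: edge_sym. Qed.
Fact induced_edge_irr : irreflexive induced_edge.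
Proof. by move=> x; apply: edge_irr. Qed.
Definition induced := SGraph induced_edge_sym induced_edge_irr.

End Constructions.

Definition connected (s : sgraph) : bool :=
  (0 < #|s|)%N && [forall x : s, forall y : s, connect edge x y].

Definition component (s : sgraph) (x : s) : {set s} :=
  [set y | connect edge x y].

Definition components (s : sgraph) : {set {set s}} :=
  [set component x | x in [set: s]%SET].

Definition restrl (s1 s2 t : sgraph) (f : {ffun disjoint_union s1 s2 -> t}) :
  {ffun s1 -> t} := [ffun x => f (inl x)].
Definition restrr (s1 s2 t : sgraph) (f : {ffun disjoint_union s1 s2 -> t}) :
  {ffun s2 -> t} := [ffun x => f (inr x)].

Definition Mcount (s1 s2 t : sgraph) : nat :=
  #|[set f in RegEpi (disjoint_union s1 s2) t |
       (restrl f \in Mono s1 t) && (restrr f \in Mono s2 t)]|.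

Definition Rcount (s1 s2 t : sgraph) : nat :=
  #|[set f in Epi (disjoint_union s1 s2) t |
       (restrl f \in RegMono s1 t) && (restrr f \in RegMono s2 t)]|.

(** Graphs on the vertex set ['I_n] form a [choiceType], so that they can be
    quotiented by isomorphism. *)
Definition adjacency := {n : nat & {ffun 'I_n * 'I_n -> bool}}.

Definition simple (a : adjacency) : bool :=
  [forall x, forall y, tagged a (x, y) == tagged a (y, x)] &&
  [forall x, ~~ tagged a (x, x)].

Record ograph := OGraph { adj : adjacency; adjP : simple adj }.
HB.instance Definition _ := [isSub for adj].
HB.instance Definition _ := [Choice of ograph by <:].

Definition oedge (g : ograph) (x y : 'I_(tag (adj g))) :=
  tagged (adj g) (x, y).
Fact oedge_sym g : symmetric (@oedge g).
Proof.
move=> x y; have /andP[/forallP/(_ x)/forallP/(_ y)/eqP h _] := adjP g; exact: h.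
Qed.
Fact oedge_irr g : irreflexive (@oedge g).
Proof. by move=> x; apply/negbTE; have /andP[_ /forallP] := adjP g; apply. Qed.
Definition sgraph_of (g : ograph) := SGraph (@oedge_sym g) (@oedge_irr g).

Definition adj_of (s : sgraph) : adjacency :=
  Tagged (fun n => {ffun 'I_n * 'I_n -> bool})
    [ffun p : 'I_#|s| * 'I_#|s| => edge (enum_val p.1 : s) (enum_val p.2)].
Fact adj_of_simple s : simple (adj_of s).
Proof.
apply/andP; split; last by apply/forallP => x; rewrite ffunE /= edge_irr.
by apply/forallP => x; apply/forallP => y; rewrite !ffunE /= edge_sym.
Qed.
Definition ograph_of (s : sgraph) : ograph := OGraph (adj_of_simple s).

Lemma IsoP (s t : sgraph) (f : {ffun s -> t}) :
  reflect [/\ injective f, (forall y, exists x, f x = y) &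
              forall x y, edge (f x) (f y) = edge x y]
          (f \in Iso s t).
Proof.
rewrite !inE; apply: (iffP idP).
  case/andP => /andP[/andP[/forallP hf /injectiveP fi] /forallP rf].
  case/andP => _ /forallP sf; split=> //.
    by move=> y; case/existsP: (sf y) => x /eqP <-; exists x.
  move=> x y; apply/idP/idP.
    by move: (rf x) => /forallP/(_ y)/implyP.
  by move: (hf x) => /forallP/(_ y)/implyP.
case=> fi sf ef; rewrite -andbA.
have hf : [forall x, forall y, edge x y ==> edge (f x) (f y)].
  by apply/forallP => x; apply/forallP => y; rewrite ef implybb.
rewrite hf /=; apply/and3P; split; first exact/injectiveP.
  by apply/forallP => x; apply/forallP => y; rewrite ef implybb.
by apply/forallP => y; case: (sf y) => x <-; apply/existsP; exists x.
Qed.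

Lemma isomorphicP (s t : sgraph) :
  reflect (exists f : s -> t, [/\ injective f, (forall y, exists x, f x = y) &
              forall x y, edge (f x) (f y) = edge x y])
          (isomorphic s t).
Proof.
apply: (iffP (finset.set0Pn _)) => [[f /IsoP]|[f [fi sf ef]]].
  by exists f.
exists (finfun f); apply/IsoP; split.
- by move=> x y; rewrite !ffunE => /fi.
- by move=> y; case: (sf y) => x <-; exists x; rewrite ffunE.
- by move=> x y; rewrite !ffunE.
Qed.

Lemma isomorphic_refl s : isomorphic s s.
Proof. by apply/isomorphicP; exists id; split=> // y; exists y. Qed.

Lemma isomorphic_trans t s u :
  isomorphic s t -> isomorphic t u -> isomorphic s u.
Proof.
move=> /isomorphicP[f [fi sf ef]] /isomorphicP[g [gi sg eg]].
apply/isomorphicP; exists (g \o f); split; first exact: inj_comp.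
  by move=> z; case: (sg z) => y <-; case: (sf y) => x <-; exists x.
by move=> x y /=; rewrite eg ef.
Qed.

Lemma isomorphic_sym s t : isomorphic s t = isomorphic t s.
Proof.
have H s' t' : isomorphic s' t' -> isomorphic t' s'.
  move=> /isomorphicP[f [fi sf ef]].
  have /boolp.choice[g gK] := sf.
  apply/isomorphicP; exists g; split.
  - by move=> x y /(congr1 f); rewrite !gK.
  - by move=> x; exists (f x); apply: fi; rewrite gK.
  - by move=> x y; rewrite -ef !gK.
by apply/idP/idP; apply: H.
Qed.

Lemma isomorphic_card s t : isomorphic s t -> #|s| = #|t|.
Proof.
move=> /isomorphicP[f [fi sf _]].
apply: (bij_eq_card (f := f)); have /boolp.choice[g gK] := sf.
by exists g => // x; apply: fi; rewrite gK.
Qed.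

Definition oiso (g h : ograph) : bool := isomorphic (sgraph_of g) (sgraph_of h).
Fact oiso_refl : reflexive oiso. Proof. by move=> g; apply: isomorphic_refl. Qed.
Fact oiso_sym : symmetric oiso. Proof. by move=> g h; apply: isomorphic_sym. Qed.
Fact oiso_trans : transitive oiso.
Proof. by move=> h g k; apply: isomorphic_trans. Qed.
Canonical oiso_equiv := EquivRel oiso oiso_refl oiso_sym oiso_trans.

Definition graph_quot := {eq_quot oiso}.
HB.instance Definition _ := EqQuotient.on graph_quot.
HB.instance Definition _ := Choice.on graph_quot.

Definition graph : choiceType := graph_quot.

Definition class (s : sgraph) : graph := \pi_graph_quot (ograph_of s).

HB.lock Definition rep (g : graph) : sgraph := sgraph_of (repr (g : graph_quot)).

Lemma sgraph_ofK s : isomorphic (sgraph_of (ograph_of s)) s.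
Proof.
apply/isomorphicP; exists (fun x => enum_val (x : 'I_#|s|)); split.
- by move=> x y; apply: enum_val_inj.
- by move=> y; exists (enum_rank y); apply: enum_rankK.
- by move=> x y; rewrite /= /oedge /= ffunE.
Qed.

Lemma classP s t : reflect (class s = class t) (isomorphic s t).
Proof.
apply: (iffP idP) => [st|/eqmodP]; rewrite /class.
  apply/eqmodP; apply: isomorphic_trans (sgraph_ofK _) _.
  by apply: isomorphic_trans st _; rewrite isomorphic_sym; apply: sgraph_ofK.
rewrite /= /oiso => st.
apply: isomorphic_trans (isomorphic_trans st (sgraph_ofK _)).
by rewrite isomorphic_sym sgraph_ofK.
Qed.

Lemma rep_class s : isomorphic (rep (class s)) s.
Proof.
rewrite rep.unlock.
have : oiso (repr (class s : graph_quot)) (ograph_of s) by apply/eqmodP; rewrite reprK.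
by move=> h; apply: isomorphic_trans (sgraph_ofK s).
Qed.

Lemma class_rep (g : graph) : class (rep g) = g.
Proof.
rewrite rep.unlock -[RHS](@reprK _ graph_quot); apply/eqmodP.
by rewrite /= /oiso; apply: sgraph_ofK.
Qed.

(** [free K] is the space of finitely supported functions [K -> rat], with
    basis [gen k]; the tensor product of [free K] and [free L] is modelled by
    [free (K ** L)], where [gen (k, l)] stands for [gen k (x) gen l]. *)

Definition free (K : choiceType) := {malg rat[K]}.
HB.instance Definition _ (K : choiceType) := GRing.Lmodule.on (free K).

HB.lock Definition gen (K : choiceType) (k : K) : free K := << k >>.

Notation "K ** L" := (Datatypes_prod__canonical__choice_Choice K L)
  (at level 40, left associativity).

HB.lock Definition lin_ext (K : choiceType) (V : lmodType rat) (f : K -> V)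
    (u : free K) : V :=
  \sum_(k <- msupp u) u@_k *: f k.

Section FreeSpaces.
Implicit Types K L M : choiceType.

Lemma lin_extEw K (V : lmodType rat) (f : K -> V) (d : {fset K}) u :
  (msupp u `<=` d)%fset -> lin_ext f u = \sum_(k <- d) u@_k *: f k.
Proof.
move=> sub; rewrite lin_ext.unlock (big_fset_incl _ sub) // => k _.
by move/mcoeff_outdom ->; apply: scale0r.
Qed.

Fact lin_ext_is_linear K (V : lmodType rat) (f : K -> V) : linear (lin_ext f).
Proof.
move=> a u v; pose d := (msupp (a *: u + v) `|` (msupp u `|` msupp v))%fset.
rewrite !(@lin_extEw _ _ f d) ?fsubsetUl //; last 2 first.
- by apply: fsubset_trans (fsubsetUr _ _); apply: fsubsetUr.
- by apply: fsubset_trans (fsubsetUr _ _); apply: fsubsetUl.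
rewrite scaler_sumr -big_split; apply: eq_bigr => k _ /=.
by rewrite mcoeffD mcoeffZ scalerDl scalerA.
Qed.
HB.instance Definition _ K (V : lmodType rat) (f : K -> V) :=
  GRing.isLinear.Build rat (free K) V _ (lin_ext f) (lin_ext_is_linear f).

Lemma genE K (k j : K) : (gen k)@_j = (k == j)%:R.
Proof. by rewrite gen.unlock; apply: mcoeffU. Qed.

Lemma msupp_gen K (k : K) : msupp (gen k) = [fset k]%fset.
Proof. by rewrite gen.unlock msuppU oner_eq0. Qed.

Lemma lin_extU K (V : lmodType rat) (f : K -> V) k : lin_ext f (gen k) = f k.
Proof.
rewrite lin_ext.unlock msupp_gen big_seq_fset1.
by rewrite genE eqxx scale1r.
Qed.

Definition tensor K L (u : free K) (v : free L) : free (K ** L) :=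
  lin_ext (fun k => lin_ext (fun l => gen ((k, l) : K ** L)) v) u.

Lemma tensorU K L (k : K) (l : L) :
  tensor (gen k) (gen l) = gen ((k, l) : K ** L).
Proof. by rewrite /tensor !lin_extU. Qed.

Definition tensor_map K L K' L' (f : free K -> free K') (g : free L -> free L') :
    free (K ** L) -> free (K' ** L') :=
  lin_ext (fun p : K ** L => tensor (f (gen p.1)) (g (gen p.2))).

Definition tensor_assoc K L M : free (K ** L ** M) -> free (K ** (L ** M)) :=
  lin_ext (fun p : K ** L ** M =>
    gen ((p.1.1, (p.1.2, p.2)) : K ** (L ** M))).

(** [a (x) b (x) c (x) d |-> a (x) c (x) b (x) d] *)
Definition tensor_swap K :
    free ((K ** K) ** (K ** K)) -> free ((K ** K) ** (K ** K)) :=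
  lin_ext (fun p : (K ** K) ** (K ** K) =>
    gen (((p.1.1, p.2.1), (p.1.2, p.2.2)) : (K ** K) ** (K ** K))).

(** [e (x) id] and [id (x) e] followed by [k (x) V = V] and [V (x) k = V] *)
Definition contractl K (e : free K -> rat) : free (K ** K) -> free K :=
  lin_ext (fun p : K ** K => e (gen p.1) *: gen p.2).
Definition contractr K (e : free K -> rat) : free (K ** K) -> free K :=
  lin_ext (fun p : K ** K => e (gen p.2) *: gen p.1).

Definition pairing K (u v : free K) : rat :=
  \sum_(k <- msupp u) u@_k * v@_k.

Lemma pairingU K (k : K) v : pairing (gen k) v = v@_k.
Proof.
by rewrite /pairing msupp_gen big_seq_fset1 genE eqxx mul1r.
Qed.

(** The junk value is [0] when [c] has infinite support; the lemmas
    [mul_monoE], [comul_homE], [Phi_mono_homE], etc. at the end of the file show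
    that this never happens for the sums over all graphs used here. *)
Definition formal_sum K (c : K -> rat) : free K :=
  (\sum_(k \in [set: K]%classic) c k *: gen k)%R.

End FreeSpaces.

Section HopfAlgebras.
Variable K : choiceType.
Local Notation V := (free K).
Local Notation VV := (free (K ** K)).

Record hopf_data := HopfData {
  hmul : {linear VV -> V};
  hone : V;
  hcomul : {linear V -> VV};
  hcounit : {linear V -> rat^o} }.

Implicit Types H : hopf_data.

Definition is_algebra H : Prop :=
  (forall a b c : V, hmul H (tensor a (hmul H (tensor b c))) =
                     hmul H (tensor (hmul H (tensor a b)) c)) /\
  (forall a : V, hmul H (tensor (hone H) a) = a) /\
  (forall a : V, hmul H (tensor a (hone H)) = a).

Definition is_coalgebra H : Prop :=
  (forall a : V, tensor_assoc (tensor_map (hcomul H) idfun (hcomul H a)) =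
                 tensor_map idfun (hcomul H) (hcomul H a)) /\
  (forall a : V, contractl (hcounit H) (hcomul H a) = a) /\
  (forall a : V, contractr (hcounit H) (hcomul H a) = a).

Definition hmul2 (m : {linear VV -> V}) (x y : VV) : VV :=
  tensor_map m m (tensor_swap (tensor x y)).

Definition is_bialgebra H : Prop :=
  is_algebra H /\ is_coalgebra H /\
  (forall a b : V, hcomul H (hmul H (tensor a b)) =
                   hmul2 (hmul H) (hcomul H a) (hcomul H b)) /\
  hcomul H (hone H) = tensor (hone H) (hone H) /\
  (forall a b : V, hcounit H (hmul H (tensor a b)) =
                   (hcounit H a : rat) * hcounit H b) /\
  hcounit H (hone H) = 1.

Definition is_antipode H (S : {linear V -> V}) : Prop :=
  forall a : V,
    hmul H (tensor_map S idfun (hcomul H a)) = (hcounit H a : rat) *: hone H /\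
    hmul H (tensor_map idfun S (hcomul H a)) = (hcounit H a : rat) *: hone H.

Definition is_hopf_algebra H : Prop :=
  is_bialgebra H /\ exists S : {linear V -> V}, is_antipode H S.

Definition is_hopf_morphism H1 H2 (f : {linear V -> V}) : Prop :=
  (forall a b : V, f (hmul H1 (tensor a b)) = hmul H2 (tensor (f a) (f b))) /\
  f (hone H1) = hone H2 /\
  (forall a : V, hcomul H2 (f a) = tensor_map f f (hcomul H1 a)) /\
  (forall a : V, hcounit H2 (f a) = hcounit H1 a) /\
  (forall S1 S2 : {linear V -> V}, is_antipode H1 S1 -> is_antipode H2 S2 ->
     forall a : V, f (S1 a) = S2 (f a)).

(** The clause on antipodes in [is_hopf_morphism] is not an existence claim;
    existence is part of [is_hopf_algebra]. *)
Definition is_hopf_isomorphism H1 H2 (f : {linear V -> V}) : Prop :=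
  is_hopf_algebra H1 /\ is_hopf_algebra H2 /\
  is_hopf_morphism H1 H2 f /\ bijective f.

End HopfAlgebras.

Notation QG := (free graph).
Notation QGG := (free (graph ** graph)).

Definition empty_graph : graph := class empty_sgraph.

Definition unit_graph : QG := gen empty_graph.

Definition counit_graph : {linear QG -> rat^o} :=
  lin_ext (fun t : graph => (t == empty_graph)%:R : rat^o).

Definition gunion (s t : graph) : graph :=
  class (disjoint_union (rep s) (rep t)).

Definition mul_hom : {linear QGG -> QG} :=
  lin_ext (fun p : graph ** graph => gen (gunion p.1 p.2)).

Definition comul_hom : {linear QG -> QGG} :=
  lin_ext (fun t : graph =>
    formal_sum (fun p : graph ** graph => pairing (gen t) (mul_hom (gen p)))).

(** A graph is the disjoint union of its connected components, so the algebra
    morphism that is primitive on connected graphs sends it to the product,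
    over its components [C], of [C (x) e + e (x) C]. The lemmas [comul_hom'1],
    [comul_hom'M], [comul_hom'_connected] and [comul_hom'_unique] below
    characterize [comul_hom'] as that morphism. *)
Definition primitive (t : graph) : QGG :=
  tensor (gen t) unit_graph + tensor unit_graph (gen t).

Definition comul_hom'_basis (s : sgraph) : QGG :=
  \big[hmul2 mul_hom/tensor unit_graph unit_graph]_(C in components s)
    primitive (class (induced C)).

Definition comul_hom' : {linear QG -> QGG} :=
  lin_ext (fun t : graph => comul_hom'_basis (rep t)).

Definition mul_hom' : {linear QGG -> QG} :=
  lin_ext (fun p : graph ** graph =>
    formal_sum (fun g : graph => pairing (gen p) (comul_hom' (gen g)))).

Definition mul_mono : {linear QGG -> QG} :=
  lin_ext (fun p : graph ** graph => formal_sum (fun g : graph =>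
    (Mcount (rep p.1) (rep p.2) (rep g))%:R / #|Aut (rep g)|%:R)).

Definition mul_mono' : {linear QGG -> QG} :=
  lin_ext (fun p : graph ** graph => formal_sum (fun g : graph =>
    (Mcount (rep p.1) (rep p.2) (rep g))%:R /
      (#|Aut (rep p.1)|%:R * #|Aut (rep p.2)|%:R))).

Definition mul_regmono : {linear QGG -> QG} :=
  lin_ext (fun p : graph ** graph => formal_sum (fun g : graph =>
    (Rcount (rep p.1) (rep p.2) (rep g))%:R / #|Aut (rep g)|%:R)).

Definition mul_regmono' : {linear QGG -> QG} :=
  lin_ext (fun p : graph ** graph => formal_sum (fun g : graph =>
    (Rcount (rep p.1) (rep p.2) (rep g))%:R /
      (#|Aut (rep p.1)|%:R * #|Aut (rep p.2)|%:R))).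

Definition graph_hopf (mul : {linear QGG -> QG}) (comul : {linear QG -> QGG}) :
    hopf_data graph :=
  HopfData mul unit_graph comul counit_graph.

Definition Phi_regmono_mono : {linear QG -> QG} :=
  lin_ext (fun t : graph => formal_sum (fun s : graph =>
    #|Mono (rep t) (rep s) :&: Epi (rep t) (rep s)|%:R / #|Aut (rep s)|%:R)).

Definition Phi_mono_hom : {linear QG -> QG} :=
  lin_ext (fun t : graph => formal_sum (fun s : graph =>
    #|RegEpi (rep t) (rep s)|%:R / #|Aut (rep s)|%:R)).

Definition Phi_regmono_hom : {linear QG -> QG} :=
  lin_ext (fun t : graph => formal_sum (fun s : graph =>
    #|Epi (rep t) (rep s)|%:R / #|Aut (rep s)|%:R)).

Definition Phi_aut : {linear QG -> QG} :=
  lin_ext (fun t : graph => #|Aut (rep t)|%:R *: gen t).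
Definition Phi_hom'_hom : {linear QG -> QG} := Phi_aut.
Definition Phi_mono'_mono : {linear QG -> QG} := Phi_aut.
Definition Phi_regmono'_regmono : {linear QG -> QG} := Phi_aut.

Lemma formal_sumE (K : choiceType) (c : K -> rat) k :
  finite_set [set i | c i != 0]%classic -> (formal_sum c)@_k = c k.
Proof.
move=> /finite_fsetP[A cA].
have c0 i : i \notin A -> c i = 0.
  move=> iA; apply/eqP; apply: contraNT iA => ci.
  by move/seteqP: cA => [+ _] => /(_ i ci).
rewrite /formal_sum (fsbigTE A); last by move=> i /c0 ->; rewrite scale0r.
rewrite raddf_sum /=.
under eq_bigr => i _ do rewrite mcoeffZ genE.
have [kA|/[dup] kA /c0 ->] := boolP (k \in A).
  rewrite (big_fsetD1 k) //= eqxx mulr1 big1_fset ?addr0 // => i.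
  by rewrite in_fsetD1 => /andP[/negbTE ->]; rewrite mulr0.
rewrite big1_fset // => i iA _; case: eqVneq => [ik|_]; last by rewrite mulr0.
by rewrite -ik iA in kA.
Qed.

Lemma free_ind (K : choiceType) (P : free K -> Prop) :
  P 0 -> (forall a u v, P u -> P v -> P (a *: u + v)) ->
  (forall k, P (gen k)) -> forall u, P u.
Proof.
move=> P0 PD PU u; rewrite [u]monalgE.
elim: (enum_fset (msupp u)) => [|k s IH]; first by rewrite big_nil.
rewrite big_cons; suff -> : << u@_k *g k >> = u@_k *: gen k :> free K by apply: PD.
by apply/malgP => j; rewrite mcoeffZ genE mcoeffU mulr_natr.
Qed.

Lemma lin_extE (K : choiceType) (V : lmodType rat) (f : K -> V) u :
  lin_ext f u = \sum_(k <- msupp u) u@_k *: f k.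
Proof. by rewrite lin_ext.unlock. Qed.

Lemma tensorDl (K L : choiceType) a (u v : free K) (w : free L) :
  tensor (a *: u + v) w = a *: tensor u w + tensor v w.
Proof. by rewrite /tensor linearP. Qed.

Lemma tensorDr (K L : choiceType) a (w : free K) (u v : free L) :
  tensor w (a *: u + v) = a *: tensor w u + tensor w v.
Proof.
rewrite /tensor !(lin_extE _ w) scaler_sumr -big_split; apply: eq_bigr => k _ /=.
rewrite linearP scalerDr !scalerA mulrC //.
Qed.

Lemma tensor0l (K L : choiceType) (w : free L) : tensor (0 : free K) w = 0.
Proof. by rewrite /tensor linear0. Qed.

Lemma tensor0r (K L : choiceType) (w : free K) : tensor w (0 : free L) = 0.
Proof. by have := tensorDr (- 1) w 0 (0 : free L); rewrite !scaleN1r !addNr. Qed.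

Section Product2.
Variables (K : choiceType) (m : {linear free (K ** K) -> free K}).
Local Notation tm := (hmul2 m).

Lemma hmul2Dl a u v w : tm (a *: u + v) w = a *: tm u w + tm v w.
Proof. by rewrite /hmul2 tensorDl /tensor_swap /tensor_map !linearP. Qed.

Lemma hmul2Dr a u v w : tm w (a *: u + v) = a *: tm w u + tm w v.
Proof. by rewrite /hmul2 tensorDr /tensor_swap /tensor_map !linearP. Qed.

Lemma hmul20l w : tm 0 w = 0.
Proof. by rewrite /hmul2 tensor0l /tensor_swap /tensor_map !linear0. Qed.

Lemma hmul20r w : tm w 0 = 0.
Proof. by rewrite /hmul2 tensor0r /tensor_swap /tensor_map !linear0. Qed.

Lemma hmul2U a b c d :
  tm (gen ((a, b) : K ** K)) (gen ((c, d) : K ** K)) =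
  tensor (m (gen ((a, c) : K ** K))) (m (gen ((b, d) : K ** K))).
Proof. by rewrite /hmul2 tensorU /tensor_swap /tensor_map !lin_extU. Qed.
End Product2.

Lemma mul_homU t1 t2 :
  mul_hom (gen ((t1, t2) : graph ** graph)) = gen (gunion t1 t2).
Proof. by rewrite /mul_hom /= lin_extU. Qed.

Lemma iso_union (s1 s2 t1 t2 : sgraph) : isomorphic s1 t1 -> isomorphic s2 t2 ->
  isomorphic (disjoint_union s1 s2) (disjoint_union t1 t2).
Proof.
move=> /isomorphicP[f [fi fs fe]] /isomorphicP[g [gi gs ge]].
apply/isomorphicP; exists (fun x : s1 + s2 => match x with inl x => inl (f x) | inr x => inr (g x) end).
split.
- by move=> [x|x] [y|y] // [] => [/fi|/gi] ->.
- move=> [y|y]; first by case: (fs y) => x <-; exists (inl x).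
  by case: (gs y) => x <-; exists (inr x).
- by move=> [x|x] [y|y] //=; rewrite ?fe ?ge.
Qed.

Lemma gunion_class s t : gunion (class s) (class t) = class (disjoint_union s t).
Proof. by apply/classP; apply: iso_union; apply: rep_class. Qed.

Lemma gunionC : commutative gunion.
Proof.
move=> s t; apply/classP/isomorphicP.
exists (fun x : rep s + rep t => match x with inl x => inr x | inr x => inl x end).
split; [by move=> [x|x] [y|y] // [] -> | | by move=> [x|x] [y|y]].
by move=> [y|y]; [exists (inr y) | exists (inl y)].
Qed.

Lemma gunionA : associative gunion.
Proof.
move=> s t u; rewrite -[in LHS](class_rep s) -[in RHS](class_rep u) !gunion_class.
apply/classP/isomorphicP.
exists (fun x : rep s + (rep t + rep u) => match x with inl x => inl (inl x)
  | inr (inl x) => inl (inr x) | inr (inr x) => inr x end).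
split.
- by move=> [x|[x|x]] [y|[y|y]] // [] ->.
- by move=> [[y|y]|y]; [exists (inl y) | exists (inr (inl y)) | exists (inr (inr y))].
- by move=> [x|[x|x]] [y|[y|y]].
Qed.

Lemma gunion1 : left_id empty_graph gunion.
Proof.
move=> s; rewrite -{1}(class_rep s) gunion_class -[RHS]class_rep.
apply/classP; rewrite isomorphic_sym; apply/isomorphicP.
exists (inr : rep s -> void + rep s); split=> //; first by move=> x y [].
by move=> [[]|y]; exists y.
Qed.

Local Notation tm := (hmul2 mul_hom).
Local Notation one2 := (tensor unit_graph unit_graph).

Lemma tmU (p q : graph ** graph) : tm (gen p) (gen q) =
  gen ((gunion p.1 q.1, gunion p.2 q.2) : graph ** graph).
Proof. by case: p q => [a b] [c d]; rewrite hmul2U !mul_homU tensorU. Qed.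

Fact tmA : associative tm.
Proof.
move=> u v w; elim/free_ind: u => [|a u u' IH IH'|p]; first by rewrite !hmul20l.
  by rewrite !hmul2Dl IH IH'.
elim/free_ind: v => [|a v v' IH IH'|q]; first by rewrite !(hmul20l, hmul20r).
  by rewrite !(hmul2Dl, hmul2Dr) IH IH'.
elim/free_ind: w => [|a w w' IH IH'|r]; first by rewrite !hmul20r.
  by rewrite !hmul2Dr IH IH'.
by rewrite !tmU /= !gunionA.
Qed.

Fact tmC : commutative tm.
Proof.
move=> u v; elim/free_ind: u => [|a u u' IH IH'|p].
- by rewrite hmul20l hmul20r.
- by rewrite hmul2Dl hmul2Dr IH IH'.
elim/free_ind: v => [|a v v' IH IH'|q].
- by rewrite hmul20l hmul20r.
- by rewrite hmul2Dl hmul2Dr IH IH'.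
by rewrite !tmU gunionC [X in (_, X)]gunionC.
Qed.

Fact tm1 : left_id one2 tm.
Proof.
elim/free_ind => [|a u u' IH IH'|[a b]]; first by rewrite hmul20r.
  by rewrite hmul2Dr IH IH'.
by rewrite tensorU tmU /= !gunion1.
Qed.

HB.instance Definition _ := Monoid.isComLaw.Build QGG one2 tm tmA tmC tm1.

Section Embedding.
Variables (s t : sgraph) (f : s -> t).
Hypothesis fi : injective f.
Hypothesis fe : forall x y, edge (f x) (f y) = edge x y.
Hypothesis fc : forall x y, edge (f x) y -> exists z, y = f z.

Lemma component_emb x : component (f x) = [set f y | y in component x]%SET.
Proof.
apply/finset.setP => y; rewrite inE; apply/idP/imsetP.
  case/connectP => p; elim: p x => [|z p IH] x /=.
    by move=> _ ->; exists x; rewrite ?inE.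
  case/andP => /[dup] xz /fc[z' zz']; rewrite zz' => pz yl.
  have [w] := IH z' pz yl; rewrite inE => zw ->; exists w => //; rewrite inE.
  by apply: connect_trans zw; apply: connect1; rewrite -fe -zz'.
case=> z; rewrite inE => xz ->; case/connectP: xz => p.
elim: p x => [|w p IH] x /=; first by move=> _ ->.
case/andP => xw pw zl; apply: connect_trans (IH w pw zl).
by apply: connect1; rewrite fe.
Qed.

Lemma induced_emb (A : {set s}) :
  class (induced [set f y | y in A]%SET) = class (induced A).
Proof.
apply/classP; rewrite isomorphic_sym; apply/isomorphicP.
have fA (x : {x | x \in A}) : f (val x) \in [set f y | y in A]%SET.
  by apply: imset_f; apply: (valP x).
exists (fun x : {x | x \in A} => exist _ (f (val x)) (fA x)); split.
- by move=> x y [] /fi /val_inj.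
- move=> [y yA]; have /imsetP[x xA yx] := yA.
  by exists (exist _ x xA); apply: val_inj.
- by move=> x y; rewrite /= /induced_edge /= fe.
Qed.

Definition imc := [set [set f y | y in (C : {set s})]%SET | C in components s]%SET.

Lemma imcE : imc = [set component (f x) | x : s]%SET.
Proof.
apply/finset.setP => C; apply/imsetP/imsetP.
  by case=> _ /imsetP[x _ ->] ->; exists x => //; rewrite component_emb.
case=> x _ ->; exists (component x); last exact: component_emb.
by apply/imsetP; exists x.
Qed.

Lemma big_imc :
  \big[tm/one2]_(C in imc) primitive (class (induced C)) = comul_hom'_basis s.
Proof.
rewrite /imc big_imset /=; last by move=> A B _ _; apply: imset_inj.
by apply: eq_bigr => C _; rewrite induced_emb.
Qed.
End Embedding.

Lemma comul_hom'_basis_iso s t : isomorphic s t ->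
  comul_hom'_basis s = comul_hom'_basis t.
Proof.
move=> /isomorphicP[f [fi fs fe]].
have fc x y : edge (f x) y -> exists z, y = f z.
  by move=> _; case: (fs y) => z <-; exists z.
rewrite -(big_imc fi fe) /comul_hom'_basis; apply: eq_bigl => C.
rewrite imcE //; apply/imsetP/imsetP => -[x _ ->]; first by exists (f x).
by case: (fs x) => y <-; exists y.
Qed.

Lemma comul_hom'_basis_union s t :
  comul_hom'_basis (disjoint_union s t) =
  tm (comul_hom'_basis s) (comul_hom'_basis t).
Proof.
have il : injective (inl : s -> disjoint_union s t) by move=> x y [].
have ir : injective (inr : t -> disjoint_union s t) by move=> x y [].
have cl (x : s) (y : disjoint_union s t) : edge (inl x : disjoint_union s t) y ->
    exists z, y = inl z by case: y => // y _; exists y.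
have cr (x : t) (y : disjoint_union s t) : edge (inr x : disjoint_union s t) y ->
    exists z, y = inr z by case: y => // y _; exists y.
rewrite -(big_imc il (fun _ _ => erefl)) -(big_imc ir (fun _ _ => erefl)).
rewrite -bigU /=.
  apply: eq_bigl => C; rewrite !inE !imcE //.
  apply/imsetP/orP => [[[x|x] _ ->]|]; first by left; apply/imsetP; exists x.
    by right; apply/imsetP; exists x.
  by case=> /imsetP[x _ ->]; [exists (inl x) | exists (inr x)].
rewrite !imcE // -finset.setI_eq0; apply/eqP/finset.setP => C.
rewrite !inE; apply/andP => -[/imsetP[x _ ->] /imsetP[y _]] /finset.setP/(_ (inl x)).
rewrite component_emb // [in RHS]component_emb //.
rewrite imset_f ?inE ?connect0 // => /esym/imsetP[] //.
Qed.

Lemma comul_hom'E s : comul_hom' (gen (class s)) = comul_hom'_basis s.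
Proof. by rewrite /comul_hom' /= lin_extU; apply/comul_hom'_basis_iso/rep_class. Qed.

Lemma comul_hom'1 : comul_hom' unit_graph = tensor unit_graph unit_graph.
Proof.
rewrite comul_hom'E /comul_hom'_basis big_pred0 // => C.
by apply/imsetP => -[[]].
Qed.

Lemma comul_hom'M u v :
  comul_hom' (mul_hom (tensor u v)) = tm (comul_hom' u) (comul_hom' v).
Proof.
elim/free_ind: u => [|a u u' IH IH'|s].
- by rewrite tensor0l !linear0 hmul20l.
- by rewrite tensorDl !linearP hmul2Dl IH IH'.
elim/free_ind: v => [|a v v' IH IH'|t].
- by rewrite tensor0r !linear0 hmul20r.
- by rewrite tensorDr !linearP hmul2Dr IH IH'.
rewrite tensorU mul_homU comul_hom'E comul_hom'_basis_union.
by rewrite -!comul_hom'E !class_rep.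
Qed.

Lemma comul_hom'_connected s : connected s ->
  comul_hom' (gen (class s)) =
    tensor (gen (class s)) unit_graph + tensor unit_graph (gen (class s)).
Proof.
case/andP => /card_gt0P[x _] /forallP sc; rewrite comul_hom'E.
have cT y : component y = [set: s]%SET.
  by apply/finset.setP => z; rewrite !inE; have /forallP := sc y; apply.
have -> : comul_hom'_basis s = primitive (class (induced [set: s]%SET)).
  rewrite /comul_hom'_basis.
  suff -> : components s = [set [set: s]%SET] by rewrite big_set1.
  apply/finset.setP => C; rewrite inE; apply/imsetP/eqP => [[y _ ->]|->] //.
  by exists x; rewrite ?cT.
suff -> : class (induced [set: s]%SET) = class s by [].
apply/classP/isomorphicP; exists val; split=> //; first exact: val_inj.
by move=> y; exists (exist _ y (finset.in_setT y)).
Qed.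

Section Uniqueness.
Variable s : sgraph.

Lemma component_eq (x y : s) : y \in component x -> component y = component x.
Proof.
rewrite inE => xy; apply/finset.setP => z; rewrite !inE.
by apply/esym/(same_connect (sym_connect_sym _) xy); apply: edge_sym.
Qed.

Lemma edge_component (x y z : s) :
  edge y z -> (y \in component x) = (z \in component x).
Proof.
move=> yz; rewrite !inE.
apply: (same_connect_r (sym_connect_sym _)); first exact: edge_sym.
exact: connect1.
Qed.

Lemma connected_component (x : s) : connected (induced (component x)).
Proof.
pose C := component x.
have xC : x \in C by rewrite inE connect0.
apply/andP; split; first by apply/card_gt0P; exists (exist _ x xC).
apply/forallP => y; apply/forallP => z.
have fc (u : induced C) (v : s) : edge (val u) v -> exists w : induced C, v = val w.
  move=> uv; have vC : v \in C by rewrite -(edge_component x uv) (valP u).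
  by exists (exist _ v vC).
have := @component_emb (induced C) s val (fun _ _ => erefl) fc y.
rewrite (component_eq (valP y)) => /finset.setP/(_ (val z)).
rewrite (valP z) => /esym/imsetP[w]; rewrite inE => yw /val_inj ->.
exact: yw.
Qed.

Lemma iso_component_split (x : s) :
  isomorphic (disjoint_union (induced (component x)) (induced (~: component x))) s.
Proof.
apply/isomorphicP.
exists (fun y => match y with inl y => val y | inr y => val y end); split.
- move=> [y|y] [z|z] yz; try by congr (_ _); apply: val_inj.
    by have := valP z; rewrite -yz finset.in_setC (valP y).
  by have := valP y; rewrite yz finset.in_setC (valP z).
- move=> y; have [yC|yC] := boolP (y \in component x).
    by exists (inl (exist _ y yC)).
  have yC' : y \in ~: component x by rewrite finset.in_setC.
  by exists (inr (exist _ y yC')).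
- move=> [y|y] [z|z] //=; apply/negbTE/negP => /(edge_component x).
    by rewrite (valP y); have := valP z; rewrite finset.in_setC => /negbTE ->.
  by rewrite (valP z); have := valP y; rewrite finset.in_setC => /negbTE ->.
Qed.
End Uniqueness.

Lemma comul_hom'_unique (D : {linear QG -> QGG}) :
  D unit_graph = tensor unit_graph unit_graph ->
  (forall u v, D (mul_hom (tensor u v)) = tm (D u) (D v)) ->
  (forall s, connected s -> D (gen (class s)) =
     tensor (gen (class s)) unit_graph + tensor unit_graph (gen (class s))) ->
  forall u, D u = comul_hom' u.
Proof.
move=> D1 DM Dc; elim/free_ind => [|a u v Hu Hv|g].
- by rewrite !linear0.
- by rewrite !linearP Hu Hv.
rewrite -(class_rep g); move: (rep g) => {g} s.
have [n] := ubnP #|s|; elim: n s => // n IH s sn.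
have [s0|/card_gt0P[x _]] := posnP #|s|.
  suff -> : class s = empty_graph by rewrite D1 comul_hom'1.
  have nos (x : s) : False by have := fintype0 x s0.
  apply/classP/isomorphicP; exists (fun x => match nos x with end).
  by split=> [x|[]|x]; case: (nos x).
have -> : gen (class s) = mul_hom (tensor
    (gen (class (induced (component x)))) (gen (class (induced (~: component x))))).
  rewrite tensorU mul_homU gunion_class; congr gen.
  by apply/esym/classP; apply: iso_component_split.
have Cx := connected_component x.
rewrite DM comul_hom'M (Dc _ Cx) -(comul_hom'_connected Cx) IH //=.
rewrite card_sig (eq_card (B := ~: component x)) // cardsCs finset.setCK.
rewrite -ltnS; apply: leq_trans sn; rewrite ltnS ltn_subrL.
by apply/andP; split; apply/card_gt0P; exists x; rewrite // inE connect0.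
Qed.

Local Open Scope classical_set_scope.

Lemma finite_order (n : nat) : finite_set [set g : graph | (#|rep g| <= n)%N].
Proof.
pose T := {k : 'I_n.+1 & {ffun 'I_k * 'I_k -> bool}}.
pose F (x : T) : graph :=
  \pi_graph_quot (odflt (ograph_of empty_sgraph)
    (insub (Tagged (fun k => {ffun 'I_k * 'I_k -> bool}) (tagged x)))).
apply: (@sub_finite_set _ _ (F @` setT)); last exact/finite_image/finite_finset.
move=> g /= gn; rewrite -[g](@reprK _ graph_quot).
move: gn; rewrite rep.unlock; case: (repr (g : graph_quot)) => -[k a] ga /=.
rewrite card_ord => kn.
exists (Tagged (fun k : 'I_n.+1 => {ffun 'I_k * 'I_k -> bool})
  (i := Ordinal (kn : (k < n.+1)%N)) a) => //.
by rewrite /F /= insubT.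
Qed.

Lemma finite_coef (c : graph -> rat) (n : nat) :
  (forall g, c g != 0 -> (#|rep g| <= n)%N) -> finite_set [set g | c g != 0].
Proof. by move=> cn; apply: sub_finite_set (finite_order n) => g /cn. Qed.

Lemma finite_coef2 (c : graph ** graph -> rat) (n : nat) :
  (forall p, c p != 0 -> (#|rep p.1| + #|rep p.2| <= n)%N) ->
  finite_set [set p | c p != 0].
Proof.
move=> cn; apply: sub_finite_set (finite_setX (finite_order n) (finite_order n)).
move=> p /cn h; split => /=.
  exact: leq_trans (leq_addr _ _) h.
exact: leq_trans (leq_addl _ _) h.
Qed.

Lemma card_union (s t : sgraph) : #|disjoint_union s t| = (#|s| + #|t|)%N.
Proof. by rewrite card_sum. Qed.

Lemma Epi_card (s t : sgraph) (f : {ffun s -> t}) :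
  f \in Epi s t -> (#|t| <= #|s|)%N.
Proof.
rewrite inE => /andP[_ /forallP fs].
rewrite -[X in (_ <= X)%N]cardsT; apply: leq_trans (leq_imset_card f _).
rewrite -cardsT; apply/subset_leq_card/fintype.subsetP => y _.
by have /existsP[x /eqP <-] := fs y; apply: imset_f.
Qed.

Lemma Epi_coef (s t : sgraph) (A : {set {ffun s -> t}}) (c : rat) :
  A \subset Epi s t -> #|A|%:R / c != 0 -> (#|t| <= #|s|)%N.
Proof.
move=> /fintype.subsetP AE Ac.
have /card_gt0P[f fA] : (0 < #|A|)%N.
  by rewrite lt0n; apply: contraNneq Ac => ->; rewrite mul0r.
exact: Epi_card (AE f fA).
Qed.

Lemma Mcount_coef (s1 s2 t : sgraph) (c : rat) :
  (Mcount s1 s2 t)%:R / c != 0 -> (#|t| <= #|s1| + #|s2|)%N.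
Proof.
rewrite -card_union; apply: Epi_coef; apply/fintype.subsetP => f.
by rewrite !inE -!andbA => /and3P[-> ->].
Qed.

Lemma Rcount_coef (s1 s2 t : sgraph) (c : rat) :
  (Rcount s1 s2 t)%:R / c != 0 -> (#|t| <= #|s1| + #|s2|)%N.
Proof.
rewrite -card_union; apply: Epi_coef; apply/fintype.subsetP => f.
by rewrite !inE -!andbA => /and3P[-> ->].
Qed.

Lemma mul_monoE s t g :
  (mul_mono (gen ((s, t) : graph ** graph)))@_g =
  (Mcount (rep s) (rep t) (rep g))%:R / #|Aut (rep g)|%:R.
Proof.
rewrite /mul_mono /= lin_extU formal_sumE //.
by apply: finite_coef => h; apply: Mcount_coef.
Qed.

Lemma mul_mono'E s t g :
  (mul_mono' (gen ((s, t) : graph ** graph)))@_g =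
  (Mcount (rep s) (rep t) (rep g))%:R /
    (#|Aut (rep s)|%:R * #|Aut (rep t)|%:R).
Proof.
rewrite /mul_mono' /= lin_extU formal_sumE //.
by apply: finite_coef => h; apply: Mcount_coef.
Qed.

Lemma mul_regmonoE s t g :
  (mul_regmono (gen ((s, t) : graph ** graph)))@_g =
  (Rcount (rep s) (rep t) (rep g))%:R / #|Aut (rep g)|%:R.
Proof.
rewrite /mul_regmono /= lin_extU formal_sumE //.
by apply: finite_coef => h; apply: Rcount_coef.
Qed.

Lemma mul_regmono'E s t g :
  (mul_regmono' (gen ((s, t) : graph ** graph)))@_g =
  (Rcount (rep s) (rep t) (rep g))%:R /
    (#|Aut (rep s)|%:R * #|Aut (rep t)|%:R).
Proof.
rewrite /mul_regmono' /= lin_extU formal_sumE //.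
by apply: finite_coef => h; apply: Rcount_coef.
Qed.

Lemma Phi_regmono_monoE t s :
  (Phi_regmono_mono (gen t))@_s =
  #|Mono (rep t) (rep s) :&: Epi (rep t) (rep s)|%:R / #|Aut (rep s)|%:R.
Proof.
rewrite /Phi_regmono_mono /= lin_extU formal_sumE //.
by apply: finite_coef => g; apply: Epi_coef; apply: finset.subsetIr.
Qed.

Lemma Phi_mono_homE t s :
  (Phi_mono_hom (gen t))@_s =
  #|RegEpi (rep t) (rep s)|%:R / #|Aut (rep s)|%:R.
Proof.
rewrite /Phi_mono_hom /= lin_extU formal_sumE //.
apply: finite_coef => g; apply: Epi_coef; apply/fintype.subsetP => f.
by rewrite inE => /andP[].
Qed.

Lemma Phi_regmono_homE t s :
  (Phi_regmono_hom (gen t))@_s =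
  #|Epi (rep t) (rep s)|%:R / #|Aut (rep s)|%:R.
Proof.
rewrite /Phi_regmono_hom /= lin_extU formal_sumE //.
by apply: finite_coef => g; apply: Epi_coef.
Qed.

Lemma card_class s : #|rep (class s)| = #|s|.
Proof. exact/isomorphic_card/rep_class. Qed.

Lemma card_gunion s t : #|rep (gunion s t)| = (#|rep s| + #|rep t|)%N.
Proof. by rewrite card_class card_union. Qed.

Lemma comul_homE t p : (comul_hom (gen t))@_p = (gunion p.1 p.2 == t)%:R.
Proof.
rewrite /comul_hom /= lin_extU formal_sumE; last first.
  apply: (@finite_coef2 _ #|rep t|) => -[a b].
  rewrite pairingU mul_homU genE -card_gunion /=.
  by case: (gunion a b =P t) => [->|].

by case: p => a b; rewrite pairingU mul_homU genE.
Qed.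

Definition homogeneous (n : nat) (x : QGG) : Prop :=
  forall p, x@_p != 0 -> (#|rep p.1| + #|rep p.2|)%N = n.

Lemma homogeneous_gen p :
  homogeneous (#|rep p.1| + #|rep p.2|) (gen (p : graph ** graph)).
Proof. by move=> q; rewrite genE; case: (p =P q) => [->|]. Qed.

Lemma homogeneousD n x y :
  homogeneous n x -> homogeneous n y -> homogeneous n (x + y).
Proof.
move=> hx hy p; rewrite mcoeffD; have [|/hx //] := eqVneq (x@_p) 0.
by move=> ->; rewrite add0r => /hy.
Qed.

Lemma homogeneousZ n a x : homogeneous n x -> homogeneous n (a *: x).
Proof. by move=> hx p; rewrite mcoeffZ mulf_eq0 negb_or => /andP[_ /hx]. Qed.

Lemma homogeneous0 n : homogeneous n 0.
Proof. by move=> p; rewrite mcoeff0 eqxx. Qed.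

Lemma homogeneous_sum n (r : seq (graph ** graph)) (F : graph ** graph -> QGG) :
  (forall k, k \in r -> homogeneous n (F k)) ->
  homogeneous n (\sum_(k <- r) F k).
Proof.
move=> hF; rewrite big_seq; elim/big_ind: _ => //; first exact: homogeneous0.
exact: homogeneousD.
Qed.

Lemma free_genE (K : choiceType) (u : free K) : u = \sum_(k <- msupp u) u@_k *: gen k.
Proof.
rewrite -(lin_extE (@gen K)); elim/free_ind: u => [|a u v Hu Hv|k].
- by rewrite linear0.
- by rewrite linearP /= -Hu -Hv.
- by rewrite lin_extU.
Qed.

Lemma homogeneousM m n x y :
  homogeneous m x -> homogeneous n y -> homogeneous (m + n) (tm x y).
Proof.
move=> hx hy; rewrite [x]free_genE [y]free_genE.
have E (r : seq (graph ** graph)) (c : graph ** graph -> rat) z :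
    tm (\sum_(k <- r) c k *: gen k) z = \sum_(k <- r) c k *: tm (gen k) z.
  elim: r => [|k r IH]; first by rewrite [in LHS]big_nil [in RHS]big_nil hmul20l.
  by rewrite [in LHS]big_cons [in RHS]big_cons hmul2Dl IH.
rewrite E; apply: homogeneous_sum => p; rewrite -mcoeff_neq0 => /hx <-.
apply: homogeneousZ; rewrite tmC E; apply: homogeneous_sum => q.
rewrite -mcoeff_neq0 => /hy <-; apply: homogeneousZ; rewrite tmU.
move=> k /homogeneous_gen ->; by rewrite /= !card_gunion addnACA addnC.
Qed.

Lemma homogeneous_comul_hom' t :
  homogeneous #|rep t| (comul_hom' (gen t)).
Proof.
have e0 : #|rep empty_graph| = 0%N by rewrite card_class card_void.
rewrite -[t in gen t]class_rep comul_hom'E /comul_hom'_basis.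
have -> : #|rep t| = (\sum_(C in components (rep t)) #|C|)%N.
  have P : finset.partition (components (rep t)) [set: rep t]%SET.
    have -> : components (rep t) = finset.equivalence_partition (connect edge) [set: rep t]%SET.
      apply: eq_imset => x; apply/finset.setP => y; by rewrite !inE.
    apply: finset.equivalence_partitionP => x y z _ _ _; split; first exact: connect0.
    move=> xy; apply: same_connect xy _; apply: sym_connect_sym; exact: edge_sym.
  by rewrite -cardsT (card_partition P).
elim/big_ind2: _ => [|m x n y|C _].
- by rewrite tensorU => p /homogeneous_gen ->; rewrite /= e0.
- by move=> hx hy; apply: homogeneousM.
have cC : #|C| = #|rep (class (induced C))|.
  by rewrite card_class card_sig.
by apply: homogeneousD; rewrite tensorU => p /homogeneous_gen ->; rewrite /= e0 cC ?addn0.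
Qed.

Lemma mul_hom'E p g : (mul_hom' (gen p))@_g = (comul_hom' (gen g))@_p.
Proof.
rewrite /mul_hom' /= lin_extU formal_sumE ?pairingU //.
apply: (@finite_coef _ (#|rep p.1| + #|rep p.2|)) => h.
by rewrite pairingU => /homogeneous_comul_hom' ->.
Qed.

(* Main.v *)
(** Counting maps into a test graph [u] turns every product into a product of
    numbers: a homomorphism out of a disjoint union is a pair of homomorphisms,
    and a homomorphism factors, uniquely up to isomorphism, as a regular
    epimorphism followed by a monomorphism, or as an epimorphism followed by a
    regular monomorphism. Hence counting (regular) monomorphisms into [u] is
    multiplicative for the (reg)mono product and, composed with [Phi], counts all
    homomorphisms. These functionals separate points, which gives the
    multiplicativity of [Phi] and the relation between the three maps. The
    coproduct [comul_hom'] of a graph sums over its splittings into two parts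
    without edges between them; a map into a disjoint union splits its source in
    that way, so [Phi] preserves the coproduct. It is bijective since it is
    triangular with respect to the number of non-adjacent pairs. The Hopf
    structure of disjoint unions is transported along these bijections; the primed
    structures arise from the unprimed ones by rescaling the basis by [#|Aut|]. *)
From HB Require Import structures.
From mathcomp Require Import all_boot all_algebra.
From mathcomp Require Import finmap.
From mathcomp Require Import boolp ring.
From mathcomp.multinomials Require Import monalg.
Require Import Defs.

Set Implicit Arguments.
Unset Strict Implicit.
Unset Printing Implicit Defensive.

Import GRing.Theory.
Local Open Scope ring_scope.

(** * Linear maps on tensor products *)

Section TensorCalculus.
Implicit Types K L : choiceType.

Lemma eq_linear_gen K (V : lmodType rat) (f g : {linear free K -> V}) :
  (forall k, f (gen k) = g (gen k)) -> f =1 g.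
Proof.
move=> fg; elim/free_ind => [|a u v Hu Hv|k]; last exact: fg.
  by rewrite !linear0.
by rewrite !linearP Hu Hv.
Qed.

Lemma lin_ext_gen K (V : lmodType rat) (f : {linear free K -> V}) :
  lin_ext (fun k => f (gen k)) =1 f.
Proof. by apply: eq_linear_gen => k /=; rewrite lin_extU. Qed.

Lemma eq_lin_ext K (V : lmodType rat) (f g : K -> V) :
  f =1 g -> lin_ext f =1 lin_ext g.
Proof. by move=> fg; apply: eq_linear_gen => k /=; rewrite !lin_extU. Qed.

Fact tensorr_linear K L (u : free K) : linear (fun v : free L => tensor u v).
Proof. by move=> a v v'; rewrite tensorDr. Qed.

HB.instance Definition _ K L u := GRing.isLinear.Build rat (free L) (free (K ** L))
  _ (@tensor K L u) (@tensorr_linear K L u).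

(** These maps are [lin_ext] by definition; copying its structure lets [linear0] and [linearP] act
    on them under their own names. *)
HB.instance Definition _ K L K' L' (f : free K -> free K') (g : free L -> free L') :=
  GRing.Linear.copy (tensor_map f g)
    (lin_ext (fun p : K ** L => tensor (f (gen p.1)) (g (gen p.2)))).
HB.instance Definition _ K L M :=
  GRing.Linear.copy (@tensor_assoc K L M) (lin_ext (fun p : K ** L ** M =>
    gen ((p.1.1, (p.1.2, p.2)) : K ** (L ** M)))).
HB.instance Definition _ K (e : free K -> rat) :=
  GRing.Linear.copy (contractl e) (lin_ext (fun p : K ** K => e (gen p.1) *: gen p.2)).
HB.instance Definition _ K (e : free K -> rat) :=
  GRing.Linear.copy (contractr e) (lin_ext (fun p : K ** K => e (gen p.2) *: gen p.1)).
End TensorCalculus.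

Lemma tensor_mapE (K L K' L' : choiceType) (f : {linear free K -> free K'})
    (g : {linear free L -> free L'}) u v :
  tensor_map f g (tensor u v) = tensor (f u) (g v).
Proof.
elim/free_ind: u => [|a u u' IH IH'|k].
- by rewrite !(tensor0l, linear0).
- by rewrite !(tensorDl, linearP) /= IH IH'.
elim/free_ind: v => [|a v v' IH IH'|l].
- by rewrite !(tensor0r, linear0).
- by rewrite !(tensorDr, linearP) /= IH IH'.
by rewrite tensorU [LHS]lin_extU.
Qed.

(** [tensor_map] reads [f] and [g] on basis elements only, so the inner maps enter as plain
    functions, which covers composites such as [tensor_map f f \o hcomul H1] that carry no declared
    linear structure. *)
Lemma tensor_map_comp (K L K' L' K2 L2 : choiceType)
    (f' : {linear free K' -> free K2}) (g' : {linear free L' -> free L2})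
    (f : free K -> free K') (g : free L -> free L') u :
  tensor_map f' g' (tensor_map f g u) = tensor_map (f' \o f) (g' \o g) u.
Proof.
elim/free_ind: u => [|a u v Hu Hv|[k l]]; first by rewrite !linear0.
  by rewrite !linearP /= Hu Hv.
by rewrite /tensor_map [in LHS]lin_extU [in RHS]lin_extU /= -tensor_mapE.
Qed.

Lemma eq_tensor_map (K L K' L' : choiceType)
    (f f' : free K -> free K') (g g' : free L -> free L') :
  f =1 f' -> g =1 g' -> tensor_map f g =1 tensor_map f' g'.
Proof. by move=> ff gg; apply: eq_lin_ext => -[k l] /=; rewrite ff gg. Qed.

Lemma tensor_assocE (K L M : choiceType) (u : free K) (v : free L) (w : free M) :
  tensor_assoc (tensor (tensor u v) w) = tensor u (tensor v w).
Proof.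
elim/free_ind: u => [|a u u' IH IH'|k].
- by rewrite !(tensor0l, linear0).
- by rewrite !(tensorDl, linearP) /= IH IH'.
elim/free_ind: v => [|a v v' IH IH'|l].
- by rewrite !(tensor0l, tensor0r, linear0).
- by rewrite !(tensorDl, tensorDr, linearP) /= IH IH'.
elim/free_ind: w => [|a w w' IH IH'|m].
- by rewrite !(tensor0l, tensor0r, linear0).
- by rewrite !(tensorDl, tensorDr, linearP) /= IH IH'.
by rewrite !tensorU [LHS]lin_extU.
Qed.

Lemma tensor_assoc_map (K L M K' L' M' : choiceType)
    (f : {linear free K -> free K'}) (g : {linear free L -> free L'})
    (h : {linear free M -> free M'}) u :
  tensor_assoc (tensor_map (tensor_map f g) h u) =
  tensor_map f (tensor_map g h) (tensor_assoc u).
Proof.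
elim/free_ind: u => [|a u v Hu Hv|[[k l] m]]; first by rewrite !linear0.
  by rewrite !linearP /= Hu Hv.
by rewrite -!tensorU tensor_assocE !tensor_mapE /= !tensor_mapE tensor_assocE.
Qed.

Section Hmul2.
Variables (K : choiceType) (m : {linear free (K ** K) -> free K}).

Lemma hmul2E u v u' v' :
  hmul2 m (tensor u v) (tensor u' v') = tensor (m (tensor u u')) (m (tensor v v')).
Proof.
elim/free_ind: u => [|a u w IH IH'|k].
- by rewrite !(tensor0l, hmul20l, linear0).
- by rewrite !(tensorDl, linearP, hmul2Dl) IH IH'.
elim/free_ind: v => [|a v w IH IH'|l].
- by rewrite !(tensor0l, tensor0r, hmul20l, linear0).
- by rewrite !(tensorDl, tensorDr, linearP, hmul2Dl) IH IH'.
elim/free_ind: u' => [|a u w IH IH'|k'].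
- by rewrite !(tensor0l, tensor0r, hmul20r, linear0).
- by rewrite !(tensorDl, tensorDr, linearP, hmul2Dr) IH IH'.
elim/free_ind: v' => [|a v w IH IH'|l'].
- by rewrite !(tensor0r, hmul20r, linear0).
- by rewrite !(tensorDr, linearP, hmul2Dr) IH IH'.
by rewrite !tensorU hmul2U.
Qed.
End Hmul2.

Lemma hmul2_map (K : choiceType) (m m' : {linear free (K ** K) -> free K})
    (f : {linear free K -> free K}) u v :
  (forall a b, f (m (tensor a b)) = m' (tensor (f a) (f b))) ->
  tensor_map f f (hmul2 m u v) = hmul2 m' (tensor_map f f u) (tensor_map f f v).
Proof.
move=> fM; elim/free_ind: u => [|a u w IH IH'|[k l]].
- by rewrite !(hmul20l, linear0).
- by rewrite !(hmul2Dl, linearP) /= IH IH'.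
elim/free_ind: v => [|a v w IH IH'|[k' l']].
- by rewrite !(hmul20r, linear0).
- by rewrite !(hmul2Dr, linearP) /= IH IH'.
by rewrite -!tensorU hmul2E !tensor_mapE hmul2E !fM.
Qed.

Section Contraction.
Variables (K : choiceType) (e : {linear free K -> rat^o}).

Lemma contractlE u v : contractl e (tensor u v) = (e u : rat) *: v.
Proof.
elim/free_ind: u => [|a u w IH IH'|k].
- by rewrite !(tensor0l, linear0) scale0r.
- by rewrite !(tensorDl, linearP) /= IH IH' scalerDl scalerA.
elim/free_ind: v => [|a v w IH IH'|l].
- by rewrite !(tensor0r, linear0).
- by rewrite !(tensorDr, linearP) /= IH IH'.
by rewrite tensorU [LHS]lin_extU.
Qed.

Lemma contractrE u v : contractr e (tensor u v) = (e v : rat) *: u.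
Proof.
elim/free_ind: v => [|a v w IH IH'|l].
- by rewrite !(tensor0r, linear0) scale0r.
- by rewrite !(tensorDr, linearP) /= IH IH' scalerDl scalerA.
elim/free_ind: u => [|a u w IH IH'|k].
- by rewrite !(tensor0l, linear0).
- by rewrite !(tensorDl, linearP) /= IH IH'.
by rewrite tensorU [LHS]lin_extU.
Qed.
End Contraction.

Lemma contractl_map (K : choiceType) (e e' : {linear free K -> rat^o})
    (f : {linear free K -> free K}) u : (forall a, e' (f a) = e a) ->
  contractl e' (tensor_map f f u) = f (contractl e u).
Proof.
move=> fe; elim/free_ind: u => [|a u v Hu Hv|[k l]]; first by rewrite !linear0.
  by rewrite !linearP /= Hu Hv.
by rewrite -!tensorU tensor_mapE !contractlE linearZ fe.
Qed.

Lemma contractr_map (K : choiceType) (e e' : {linear free K -> rat^o})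
    (f : {linear free K -> free K}) u : (forall a, e' (f a) = e a) ->
  contractr e' (tensor_map f f u) = f (contractr e u).
Proof.
move=> fe; elim/free_ind: u => [|a u v Hu Hv|[k l]]; first by rewrite !linear0.
  by rewrite !linearP /= Hu Hv.
by rewrite -!tensorU tensor_mapE !contractrE linearZ fe.
Qed.

Lemma tensorZl (K L : choiceType) a (u : free K) (v : free L) :
  tensor (a *: u) v = a *: tensor u v.
Proof. by have := tensorDl a u 0 v; rewrite addr0 tensor0l addr0. Qed.

Lemma tensorZr (K L : choiceType) a (u : free K) (v : free L) :
  tensor u (a *: v) = a *: tensor u v.
Proof. by have := tensorDr a u v 0; rewrite addr0 tensor0r addr0. Qed.

(** * Hopf algebras *)

Section Antipodes.
Variables (K : choiceType) (H : hopf_data K).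
Local Notation V := (free K).
Local Notation m := (hmul H).
Local Notation D := (hcomul H).
Local Notation e := (hcounit H).

(** An antipode is a two-sided inverse of the identity for convolution, and in a monoid a left
    inverse equals a right inverse: the threefold convolution of [S1], [id] and [S2] is evaluated
    with both bracketings. *)
Lemma antipode_unique (S1 S2 : {linear V -> V}) :
  is_bialgebra H -> is_antipode H S1 -> is_antipode H S2 -> S1 =1 S2.
Proof.
move=> [[mA [m1l m1r]] [[DA [D1l D1r]] _]] a1 a2 a.
(* [T] sends the basis tensor of [x], [y], [z] to the product of [S1 x], [y] and [S2 z]. *)
pose T (p : K ** (K ** K)) : V :=
  m (tensor (S1 (gen p.1)) (m (tensor (gen p.2.1) (S2 (gen p.2.2))))).
have TE u v w : lin_ext T (tensor u (tensor v w)) =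
    m (tensor (S1 u) (m (tensor v (S2 w)))).
  elim/free_ind: u => [|b u u' IH IH'|k].
  - by rewrite !(tensor0l, linear0).
  - by rewrite !(tensorDl, linearP) /= IH IH'.
  elim/free_ind: v => [|b v v' IH IH'|l].
  - by rewrite !(tensor0l, tensor0r, linear0).
  - by rewrite !(tensorDl, tensorDr, linearP) /= IH IH'.
  elim/free_ind: w => [|b w w' IH IH'|n].
  - by rewrite !(tensor0r, linear0).
  - by rewrite !(tensorDr, linearP) /= IH IH'.
  by rewrite !tensorU lin_extU.
(* The last two factors collapse to a counit by the antipode law of [S2]; in [Tl] the first two
   collapse by that of [S1]. *)
have Tr x : lin_ext T (tensor_map idfun D x) = S1 (contractr e x).
  elim/free_ind: x => [|b u v IH IH'|[k l]].
  - by rewrite !linear0.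
  - by rewrite !linearP /= IH IH'.
  rewrite -!tensorU contractrE linearZ /= tensor_mapE /=.
  rewrite -[S1 _ in RHS]m1r -linearZ /= -tensorZr -(a2 (gen l)).2.
  elim/free_ind: (D (gen l)) => [|b u v IH IH'|[k' l']].
  - by rewrite !(tensor0r, linear0).
  - by rewrite !(tensorDr, linearP) /= IH IH'.
  by rewrite -!tensorU TE tensor_mapE.
have Tl x : lin_ext T (tensor_assoc (tensor_map D idfun x)) = S2 (contractl e x).
  elim/free_ind: x => [|b u v IH IH'|[k l]].
  - by rewrite !linear0.
  - by rewrite !linearP /= IH IH'.
  rewrite -!tensorU contractlE linearZ /= tensor_mapE /=.
  rewrite -[S2 _ in RHS]m1l -linearZ /= -tensorZl -(a1 (gen k)).1.
  elim/free_ind: (D (gen k)) => [|b u v IH IH'|[k' l']].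
  - by rewrite !(tensor0l, linear0).
  - by rewrite !(tensorDl, linearP) /= IH IH'.
  by rewrite -!tensorU tensor_assocE TE tensor_mapE /= mA.
by rewrite -[in LHS](D1r a) -[in RHS](D1l a) -Tr -Tl DA.
Qed.
End Antipodes.

Section Transport.
Variables (K : choiceType) (H1 H2 : hopf_data K) (f : {linear free K -> free K}).
Local Notation V := (free K).

Hypothesis fM : forall a b, f (hmul H1 (tensor a b)) = hmul H2 (tensor (f a) (f b)).
Hypothesis f1 : f (hone H1) = hone H2.
Hypothesis fD : forall a, hcomul H2 (f a) = tensor_map f f (hcomul H1 a).
Hypothesis fe : forall a, hcounit H2 (f a) = hcounit H1 a.
Hypothesis fB : bijective f.

(** Each axiom for [H2] is evaluated at points [f (g a)] and becomes the image under [f] of the same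
    axiom for [H1]. The antipode of [H2] is the conjugate of [S] by [f]. *)
Lemma hopf_transport : is_hopf_algebra H1 -> is_hopf_isomorphism H1 H2 f.
Proof.
move=> [B1 [S aS]]; have := B1.
case=> -[mA [m1l m1r]] [[DA [D1l D1r]] [DM [D1 [eM e1]]]].
have [g gK fK] := fB.
have gL : linear g by move=> a u v; apply: (can_inj gK); rewrite linearP !fK.
(* The inverse [g] is only a function, so the conjugate of [S] is defined on the basis and extended;
   linearity of [g] then gives [S'E]. *)
pose S' : {linear V -> V} := lin_ext (fun k => f (S (g (gen k)))).
have S'E a : S' (f a) = f (S a).
  rewrite /S' /= -[in RHS](gK a); elim/free_ind: (f a) => [|b u v IH IH'|k].
  - have g0 : g 0 = 0 by have := gL (- 1) 0 0; rewrite scaler0 addr0 scaleN1r addNr.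
    by rewrite linear0 g0 !linear0.
  - by rewrite gL !linearP /= IH IH'.
  by rewrite lin_extU.
have B2 : is_bialgebra H2.
  split; [split; [|split]|split; [split; [|split]|split; [|split; [|split]]]].
  - by move=> a b c; rewrite -(fK a) -(fK b) -(fK c) -!fM mA.
  - by move=> a; rewrite -(fK a) -f1 -!fM m1l.
  - by move=> a; rewrite -(fK a) -f1 -!fM m1r.
  - move=> a; rewrite -(fK a) fD !tensor_map_comp /=.
    (* Both sides are rewritten as [f] applied in all three tensor factors after the two coproducts
       of [H1], where coassociativity of [H1] applies. *)
    rewrite (eq_tensor_map (f' := tensor_map f f \o hcomul H1) (g' := f \o idfun)) //.
    rewrite (eq_tensor_map (f := idfun \o f) (f' := f \o idfun)
      (g' := tensor_map f f \o hcomul H1)) //.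
    rewrite -(tensor_map_comp (tensor_map f f) f (hcomul H1) idfun).
    rewrite -(tensor_map_comp f (tensor_map f f) idfun (hcomul H1)).
    by rewrite tensor_assoc_map DA.
  - by move=> a; rewrite -(fK a) fD (contractl_map _ fe) D1l.
  - by move=> a; rewrite -(fK a) fD (contractr_map _ fe) D1r.
  - move=> a b; rewrite -(fK a) -(fK b) -fM !fD DM; exact: hmul2_map.
  - by rewrite -f1 fD D1 tensor_mapE.
  - by move=> a b; rewrite -(fK a) -(fK b) -fM !fe eM.
  - by rewrite -f1 fe e1.
have aS' : is_antipode H2 S'.
  have fm x : hmul H2 (tensor_map f f x) = f (hmul H1 x).
    elim/free_ind: x => [|b u v IH IH'|[k l]]; first by rewrite !linear0.
      by rewrite !linearP /= IH IH'.
    by rewrite -tensorU tensor_mapE fM.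
  move=> a; rewrite -(fK a) fD fe -f1 -linearZ /= !tensor_map_comp.
  rewrite (eq_tensor_map (f' := f \o S) (g' := f \o idfun)) //.
  rewrite (eq_tensor_map (f := idfun \o f) (f' := f \o idfun) (g' := f \o S)) //.
  rewrite -(tensor_map_comp f f S idfun) -(tensor_map_comp f f idfun S).
  by rewrite !fm (aS _).1 (aS _).2.
split; first by split=> //; exists S.
split; first by split=> //; exists S'.
split=> //; split=> //; split=> //; split=> //; split=> // S1 S2 a1 a2 a.
(* The antipodes in this clause are arbitrary; uniqueness identifies them with [S] and [S'], for
   which the claim is [S'E]. *)
by rewrite (antipode_unique B1 a1 aS) (antipode_unique B2 a2 aS').
Qed.

End Transport.

(** Since [f] is onto, every identity required of [g] may be checked at points [f a], where it
    becomes the corresponding identity for [h]. *)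
Lemma hopf_transport_cancel (K : choiceType) (H1 H2 H3 : hopf_data K)
    (f g h : {linear free K -> free K}) : (forall a, h a = g (f a)) ->
  is_hopf_isomorphism H1 H2 f -> is_hopf_isomorphism H1 H3 h ->
  is_hopf_isomorphism H2 H3 g.
Proof.
move=> hE [_ [A2 [[fM [f1 [fD [fe _]]]] fB]]] [_ [_ [[hM [h1 [hD [he _]]]] hB]]].
have [f' fK f'K] := fB.
have [h' hK h'K] := hB.
have gE a : g a = h (f' a) by rewrite hE f'K.
apply: hopf_transport => //.
- by move=> a b; rewrite -(f'K a) -(f'K b) -fM -!hE hM.
- by rewrite -f1 -hE h1.
- move=> a; rewrite -(f'K a) -hE hD fD tensor_map_comp.
  by apply: eq_tensor_map => b; rewrite /= hE.
- by move=> a; rewrite -(f'K a) -hE he fe.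
- exists (f \o h') => a /=; first by rewrite gE hK f'K.
  by rewrite -hE h'K.
Qed.

(** * Graph morphisms *)

Section MorphismPredicates.
Variables (s t : sgraph) (f : {ffun s -> t}).

Lemma HomP : reflect (forall x y, edge x y -> edge (f x) (f y)) (f \in Hom s t).
Proof.
rewrite inE; apply: (iffP forallP) => fh x.
  by move=> y; have /forallP/(_ y)/implyP := fh x.
by apply/forallP => y; apply/implyP; apply: fh.
Qed.

Lemma MonoP : reflect (f \in Hom s t /\ injective f) (f \in Mono s t).
Proof. by rewrite [f \in Mono _ _]in_set; apply: (iffP andP) => -[fh /injectiveP]. Qed.

Lemma RegMonoP : reflect (injective f /\ forall x y, edge (f x) (f y) = edge x y)
  (f \in RegMono s t).
Proof.
rewrite [f \in RegMono _ _]in_set.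
apply: (iffP andP) => [[/MonoP[/HomP fh fi] /forallP fr]|[fi fe]].
  split=> // x y; apply/idP/idP; last exact: fh.
  by have /forallP/(_ y)/implyP := fr x.
split; first by apply/MonoP; split=> //; apply/HomP => x y; rewrite fe.
by apply/forallP => x; apply/forallP => y; rewrite fe implybb.
Qed.

Lemma EpiP : reflect (f \in Hom s t /\ forall y, exists x, f x = y) (f \in Epi s t).
Proof.
rewrite [f \in Epi _ _]in_set; apply: (iffP andP) => -[fh fs]; split=> //.
  by move=> y; have /forallP/(_ y)/existsP[x /eqP] := fs; exists x.
by apply/forallP => y; have [x fx] := fs y; apply/existsP; exists x; apply/eqP.
Qed.

Lemma RegEpiP : reflect (f \in Epi s t /\ forall y1 y2, edge y1 y2 ->
    exists x1 x2, [/\ edge x1 x2, f x1 = y1 & f x2 = y2]) (f \in RegEpi s t).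
Proof.
rewrite [f \in RegEpi _ _]in_set; apply: (iffP andP) => -[fh fs]; split=> //.
  move=> y1 y2 y12; have /forallP/(_ y1)/forallP/(_ y2)/implyP/(_ y12) := fs.
  by case/existsP=> x1 /existsP[x2 /and3P[? /eqP ? /eqP ?]]; exists x1, x2.
apply/forallP => y1; apply/forallP => y2; apply/implyP => /fs[x1 [x2 [x12 e1 e2]]].
by apply/existsP; exists x1; apply/existsP; exists x2; rewrite x12 e1 e2 !eqxx.
Qed.
End MorphismPredicates.

Lemma RegEpi_sub_Epi (s t : sgraph) : RegEpi s t \subset Epi s t.
Proof. by apply/subsetP => f /RegEpiP[]. Qed.

Lemma RegMono_sub_Mono (s t : sgraph) : RegMono s t \subset Mono s t.
Proof. by apply/subsetP => f; rewrite inE => /andP[]. Qed.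

Definition comp_ffun (s t u : finType) (g : {ffun t -> u}) (f : {ffun s -> t}) :
  {ffun s -> u} := [ffun x => g (f x)].

Lemma comp_ffunE (s t u : finType) (g : {ffun t -> u}) (f : {ffun s -> t}) :
  comp_ffun g f =1 g \o f.
Proof. by move=> x; rewrite ffunE. Qed.

Lemma Hom_comp (s t u : sgraph) (g : {ffun t -> u}) (f : {ffun s -> t}) :
  g \in Hom t u -> f \in Hom s t -> comp_ffun g f \in Hom s u.
Proof.
by move=> /HomP gh /HomP fh; apply/HomP => x y xy; rewrite !comp_ffunE; apply/gh/fh.
Qed.

(** An equality of conditions, not mere closure: it moves a condition on a composite to its first
    factor when maps are sorted by their factorization. [RegMono_comp] serves the same purpose. *)
Lemma Mono_comp (s t u : sgraph) (g : {ffun t -> u}) (f : {ffun s -> t}) :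
  g \in Mono t u -> f \in Hom s t -> (comp_ffun g f \in Mono s u) = (f \in Mono s t).
Proof.
move=> /MonoP[gh gi] fh; apply/MonoP/MonoP => -[_ fi]; split=> //.
- by move=> x y fxy; apply: fi; rewrite !comp_ffunE /= fxy.
- exact: Hom_comp.
- by move=> x y; rewrite !comp_ffunE => /gi/fi.
Qed.

Lemma RegMono_comp (s t u : sgraph) (g : {ffun t -> u}) (f : {ffun s -> t}) :
  g \in RegMono t u -> (comp_ffun g f \in RegMono s u) = (f \in RegMono s t).
Proof.
move=> /RegMonoP[gi ge]; apply/RegMonoP/RegMonoP => -[fi fe]; split.
- by move=> x y fxy; apply: fi; rewrite !comp_ffunE /= fxy.
- by move=> x y; rewrite -fe !comp_ffunE /= ge.
- by move=> x y; rewrite !comp_ffunE => /gi/fi.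
- by move=> x y; rewrite !comp_ffunE /= ge fe.
Qed.

Lemma Epi_comp (s t u : sgraph) (g : {ffun t -> u}) (f : {ffun s -> t}) :
  g \in Epi t u -> f \in Epi s t -> comp_ffun g f \in Epi s u.
Proof.
move=> /EpiP[gh gs] /EpiP[fh fs]; apply/EpiP; split; first exact: Hom_comp.
by move=> z; have [y <-] := gs z; have [x <-] := fs y; exists x; rewrite ffunE.
Qed.

Lemma RegEpi_comp (s t u : sgraph) (g : {ffun t -> u}) (f : {ffun s -> t}) :
  g \in RegEpi t u -> f \in RegEpi s t -> comp_ffun g f \in RegEpi s u.
Proof.
move=> /RegEpiP[ge gr] /RegEpiP[fe fr]; apply/RegEpiP; split; first exact: Epi_comp.
move=> z1 z2 /gr[y1 [y2 [/fr[x1 [x2 [x12 <- <-]]] <- <-]]].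
by exists x1, x2; rewrite !ffunE.
Qed.

Lemma Iso_comp (s t u : sgraph) (g : {ffun t -> u}) (f : {ffun s -> t}) :
  g \in Iso t u -> f \in Iso s t -> comp_ffun g f \in Iso s u.
Proof.
rewrite !in_setI => /andP[gm ge] /andP[fm fe].
by rewrite RegMono_comp // fm Epi_comp.
Qed.

Lemma Iso_sub_RegMono (s t : sgraph) : Iso s t \subset RegMono s t.
Proof. exact: subsetIl. Qed.

Lemma Iso_sub_RegEpi (s t : sgraph) : Iso s t \subset RegEpi s t.
Proof.
apply/subsetP => f /[dup]; rewrite {1}in_setI => /andP[_ fe] /IsoP[_ fs fd].
apply/RegEpiP; split=> // y1 y2; have [x1 <-] := fs y1; have [x2 <-] := fs y2.
by rewrite fd; exists x1, x2.
Qed.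

Lemma Iso_sub_Epi (s t : sgraph) : Iso s t \subset Epi s t.
Proof. exact: subsetIr. Qed.

Lemma Iso_inv (s t : sgraph) (f : {ffun s -> t}) : f \in Iso s t ->
  exists g : {ffun t -> s}, [/\ g \in Iso t s, cancel f g & cancel g f].
Proof.
move=> /IsoP[fi fs fe]; have /boolp.choice[g gK] := fs.
have fK : cancel f [ffun y => g y] by move=> x; apply: fi; rewrite ffunE gK.
have gK' : cancel [ffun y => g y] f by move=> y; rewrite ffunE gK.
exists [ffun y => g y]; split=> //; apply/IsoP; split.
- exact: can_inj gK'.
- by move=> x; exists (f x); rewrite fK.
- by move=> x y; rewrite -fe !gK'.
Qed.

Lemma id_Iso (s : sgraph) : [ffun x : s => x] \in Iso s s.
Proof.
by apply/IsoP; split=> [x y|y|x y]; rewrite ?ffunE //; exists y; rewrite ffunE.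
Qed.

Lemma isomorphicE (s t : sgraph) : reflect (exists f, f \in Iso s t) (isomorphic s t).
Proof. exact: set0Pn. Qed.

Lemma Aut_gt0 (s : sgraph) : (0 < #|Aut s|)%N.
Proof. by apply/card_gt0P; exists [ffun x => x]; apply: id_Iso. Qed.

Lemma Aut_neq0 (s : sgraph) : #|Aut s|%:R != 0 :> rat.
Proof. by rewrite Num.Theory.pnatr_eq0 -lt0n Aut_gt0. Qed.

Section IsoInvariance.
Variable X : forall s t : sgraph, {set {ffun s -> t}}.
Hypothesis Xl : forall (s t u : sgraph) (g : {ffun t -> u}) (f : {ffun s -> t}),
  g \in Iso t u -> f \in X s t -> comp_ffun g f \in X s u.
Hypothesis Xr : forall (s t u : sgraph) (g : {ffun t -> u}) (f : {ffun s -> t}),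
  f \in Iso s t -> g \in X t u -> comp_ffun g f \in X s u.

(** Composing with isomorphisms on both sides injects each of the two sets into the other. *)
Lemma card_iso_invariant s s' t t' : isomorphic s s' -> isomorphic t t' ->
  #|X s t| = #|X s' t'|.
Proof.
have le s1 s2 t1 t2 : isomorphic s1 s2 -> isomorphic t1 t2 -> (#|X s1 t1| <= #|X s2 t2|)%N.
  move=> /isomorphicE[p /Iso_inv[q [qI pK qK]]] /isomorphicE[r rI].
  have /IsoP[ri _ _] := rI.
  rewrite -(card_imset (f := fun f : {ffun s1 -> t1} => comp_ffun r (comp_ffun f q))).
    by apply/subset_leq_card/subsetP => _ /imsetP[f fX ->]; apply/Xl/Xr.
  move=> f g fg; apply/ffunP => x; have /ffunP/(_ (p x)) := fg.
  by rewrite !ffunE pK => /ri.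
move=> ss tt; apply/eqP; rewrite eqn_leq !le // isomorphic_sym //.
Qed.
End IsoInvariance.

(** The boolean is read as 0 or 1: the set of isomorphisms is empty, or invariance in the target
    replaces [t] by [s]. *)
Lemma card_Iso (s t : sgraph) : #|Iso s t| = (isomorphic s t * #|Aut s|)%N.
Proof.
have [st|st] := boolP (isomorphic s t).
  rewrite mul1n; apply: card_iso_invariant; last by rewrite isomorphic_sym.
  - by move=> *; apply: Iso_comp.
  - by move=> *; apply: Iso_comp.
  - exact: isomorphic_refl.
by apply/eqP; rewrite mul0n cards_eq0; apply/negPn.
Qed.

Lemma card_Aut_iso (s t : sgraph) : isomorphic s t -> #|Aut s| = #|Aut t|.
Proof. by move=> st; apply: card_iso_invariant => // *; apply: Iso_comp. Qed.

Lemma card_Aut_class (s : sgraph) : #|Aut (rep (class s))| = #|Aut s|.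
Proof. exact/card_Aut_iso/rep_class. Qed.

(** * Maps into a disjoint union *)

(** No edge leaves [A]; equivalently, [A] is a union of connected components. *)
Definition edge_closed (s : sgraph) (A : {set s}) : bool :=
  [forall x, forall y, edge x y ==> ((x \in A) == (y \in A))].

Lemma edge_closedP (s : sgraph) (A : {set s}) :
  reflect (forall x y, edge x y -> (x \in A) = (y \in A)) (edge_closed A).
Proof.
apply: (iffP forallP) => [h x y xy|h x].
  by have /forallP/(_ y) := h x; rewrite xy => /eqP.
by apply/forallP => y; apply/implyP => xy; apply/eqP/h.
Qed.

Section Glue.
Variables (s a b : sgraph) (A : {set s}).

(** The match on [boolP] retains the membership proof from which a vertex of the induced subgraph is
    built. *)
Definition split_mem (x : s) : induced A + induced (~: A) :=
  match boolP (x \in A) with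
  | AltTrue xA => inl (exist _ x xA)
  | AltFalse xA => inr (exist _ x (introT setCP (negP xA)))
  end.

Lemma split_meml (x : induced A) : split_mem (val x) = inl x.
Proof.
rewrite /split_mem; case: {-}_ / boolP => xA; first by congr inl; apply: val_inj.
by case/negP: (xA); apply: valP.
Qed.

Lemma split_memr (x : induced (~: A)) : split_mem (val x) = inr x.
Proof.
rewrite /split_mem; case: {-}_ / boolP => xA; last by congr inr; apply: val_inj.
by have := valP x; rewrite inE xA.
Qed.

Variant split_mem_spec (x : s) : Prop :=
  | SplitMemIn (y : induced A) of x = val y
  | SplitMemOut (y : induced (~: A)) of x = val y.

Lemma split_memP x : split_mem_spec x.
Proof.
have [xA|xA] := boolP (x \in A); first exact: (@SplitMemIn _ (exist _ x xA)).
have xA' : x \in ~: A by rewrite inE.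
exact: (@SplitMemOut _ (exist _ x xA')).
Qed.

Definition glue (g : {ffun induced A -> a}) (h : {ffun induced (~: A) -> b}) :
    {ffun s -> disjoint_union a b} :=
  [ffun x => match split_mem x with inl y => inl (g y) | inr y => inr (h y) end].

Variables (g : {ffun induced A -> a}) (h : {ffun induced (~: A) -> b}).

Lemma gluel (x : induced A) : glue g h (val x) = inl (g x).
Proof. by rewrite ffunE split_meml. Qed.

Lemma gluer (x : induced (~: A)) : glue g h (val x) = inr (h x).
Proof. by rewrite ffunE split_memr. Qed.

(** A disjoint union has no edge between its two sides, so an edge of [s] leaving [A] would have no
    possible image; the edges inside [A] and inside its complement are handled by [g] and [h]. *)
Lemma glue_Hom : (glue g h \in Hom s (disjoint_union a b)) =
  [&& edge_closed A, g \in Hom _ a & h \in Hom _ b].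
Proof.
apply/HomP/and3P => [fh|[/edge_closedP cA /HomP gh /HomP hh] x y].
  split; [apply/edge_closedP => x y|apply/HomP => x y|apply/HomP => x y].
  - case: (split_memP x) (split_memP y) => [x' ->|x' ->] [y' ->|y' ->] /fh;
      rewrite ?gluel ?gluer // => _; rewrite ?(valP x') ?(valP y') //.
    by have := valP x'; have := valP y'; rewrite !inE => /negbTE -> /negbTE ->.
  - by move=> /(fh (val x) (val y)); rewrite !gluel.
  - by move=> /(fh (val x) (val y)); rewrite !gluer.
case: (split_memP x) (split_memP y) => [x' ->|x' ->] [y' ->|y' ->];
  rewrite ?gluel ?gluer.
- exact: gh.
- by move=> /cA; rewrite (valP x') => /esym y'A; have := valP y'; rewrite inE y'A.
- by move=> /cA; rewrite (valP y') => x'A; have := valP x'; rewrite inE x'A.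
- exact: hh.
Qed.

Lemma glue_Epi : (glue g h \in Epi s (disjoint_union a b)) =
  [&& edge_closed A, g \in Epi _ a & h \in Epi _ b].
Proof.
apply/EpiP/and3P => [[]|[cA /EpiP[gh gs] /EpiP[hh hs]]].
  rewrite glue_Hom => /and3P[cA gh hh] fs; split=> //; apply/EpiP; split=> // y.
    have [x] := fs (inl y); case: (split_memP x) => x' ->; rewrite ?gluel ?gluer //.
    by case=> <-; exists x'.
  have [x] := fs (inr y); case: (split_memP x) => x' ->; rewrite ?gluel ?gluer //.
  by case=> <-; exists x'.
split; first by rewrite glue_Hom cA gh.
case=> y; first by have [x <-] := gs y; exists (val x); rewrite gluel.
by have [x <-] := hs y; exists (val x); rewrite gluer.
Qed.

Lemma glue_RegEpi : (glue g h \in RegEpi s (disjoint_union a b)) =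
  [&& edge_closed A, g \in RegEpi _ a & h \in RegEpi _ b].
Proof.
apply/RegEpiP/and3P => [[]|[cA /RegEpiP[gE gr] /RegEpiP[hE hr]]].
  rewrite glue_Epi => /and3P[cA gE hE] fr.
  split=> //; apply/RegEpiP; split=> // y1 y2 y12.
    have [x1 [x2 []]] := fr (inl y1) (inl y2) y12.
    case: (split_memP x1) (split_memP x2) => [z1 ->|z1 ->] [z2 ->|z2 ->];
      rewrite ?gluel ?gluer // => x12 [<-] [<-].
    by exists z1, z2.
  have [x1 [x2 []]] := fr (inr y1) (inr y2) y12.
  case: (split_memP x1) (split_memP x2) => [z1 ->|z1 ->] [z2 ->|z2 ->];
    rewrite ?gluel ?gluer // => x12 [<-] [<-].
  by exists z1, z2.
split; first by rewrite glue_Epi cA gE.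
case=> y1 [] y2 //= => [/gr|/hr] [x1 [x2 [x12 <- <-]]];
  by exists (val x1), (val x2); rewrite ?gluel ?gluer.
Qed.

Lemma glue_RegMono : (glue g h \in RegMono s (disjoint_union a b)) =
  [&& edge_closed A, g \in RegMono _ a & h \in RegMono _ b].
Proof.
apply/RegMonoP/and3P => [[fi fe]|[/edge_closedP cA /RegMonoP[gi ge] /RegMonoP[hi he]]].
  have fh : glue g h \in Hom s (disjoint_union a b) by apply/HomP => x y; rewrite fe.
  split; first by move: fh; rewrite glue_Hom => /and3P[].
    apply/RegMonoP; split=> x y; last by rewrite -[RHS](fe (val x) (val y)) !gluel.
    by move=> gxy; apply/val_inj/fi; rewrite !gluel gxy.
  apply/RegMonoP; split=> x y; last by rewrite -[RHS](fe (val x) (val y)) !gluer.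
  by move=> gxy; apply/val_inj/fi; rewrite !gluer gxy.
split=> x y; case: (split_memP x) (split_memP y) => [x' ->|x' ->] [y' ->|y' ->];
    rewrite ?gluel ?gluer //.
- by case=> /gi ->.
- by case=> /hi ->.
- exact: ge.
- apply/esym/negP => /cA; rewrite (valP x') => /esym y'A.
  by have := valP y'; rewrite inE y'A.
- apply/esym/negP => /cA; rewrite (valP y') => x'A.
  by have := valP x'; rewrite inE x'A.
- exact: he.
Qed.

Lemma glue_Iso : (glue g h \in Iso s (disjoint_union a b)) =
  [&& edge_closed A, g \in Iso _ a & h \in Iso _ b].
Proof.
rewrite ![_ \in Iso _ _]in_setI glue_RegMono glue_Epi.
by case: edge_closed => //=; rewrite andbACA.
Qed.

Definition left_part (f : {ffun s -> disjoint_union a b}) : {set s} :=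
  [set x | if f x is inl _ then true else false].

Lemma left_part_glue : left_part (glue g h) = A.
Proof.
apply/setP => x; rewrite inE; case: (split_memP x) => y ->.
  by rewrite gluel; apply/esym/valP.
by rewrite gluer; have := valP y; rewrite inE => /negbTE.
Qed.
End Glue.

Lemma glue_exists (s a b : sgraph) (f : {ffun s -> disjoint_union a b}) :
  exists g h, f = glue (A := left_part f) g h.
Proof.
have /boolp.choice[g gE] (x : induced (left_part f)) : exists y, f (val x) = inl y.
  by have := valP x; rewrite inE; case: (f _) => // y _; exists y.
have /boolp.choice[h hE] (x : induced (~: left_part f)) : exists y, f (val x) = inr y.
  by have := valP x; rewrite !inE; case: (f _) => // y _; exists y.
exists [ffun x => g x], [ffun x => h x]; apply/ffunP => x.
case: (split_memP (left_part f) x) => y ->; first by rewrite gluel ffunE gE.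
by rewrite gluer ffunE hE.
Qed.

(** A map into [a] and [b] side by side determines [A] as the preimage of [a], and then its two
    restrictions. Sorting maps by [A] gives the sum. *)
Lemma card_glue (X : forall s t : sgraph, {set {ffun s -> t}}) (s a b : sgraph) :
  (forall (A : {set s}) g h, (glue g h \in X s (disjoint_union a b)) =
     [&& edge_closed A, g \in X (induced A) a & h \in X (induced (~: A)) b]) ->
  #|X s (disjoint_union a b)| =
    (\sum_(A : {set s} | edge_closed A) #|X (induced A) a| * #|X (induced (~: A)) b|)%N.
Proof.
move=> XU; rewrite -sum1_card (partition_big (@left_part s a b) (@edge_closed s)) /=;
  last by move=> f; have [g [h {1}->]] := glue_exists f; rewrite XU => /and3P[].
apply: eq_bigr => A cA; rewrite -cardsX sum1dep_card.
rewrite -(card_imset (f := fun p => glue p.1 p.2)).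
  apply: eq_card => f; rewrite inE; apply/andP/imsetP => [[fX /eqP fA]|].
    have [g [h fE]] := glue_exists f; move: fX; rewrite fE XU.
    (* The types of [g] and [h] depend on [left_part f], so [A] itself is replaced by it. *)
    case/and3P=> _ gX hX; case: A / fA in cA *; exists (g, h) => //.
    by rewrite in_setX gX.
  case=> -[g h]; rewrite in_setX => /andP[gX hX] ->.
  by rewrite XU cA gX hX left_part_glue.
move=> [g h] [g' h'] /= /ffunP e; congr (_, _); apply/ffunP => x.
  by have := e (val x); rewrite !gluel => -[].
by have := e (val x); rewrite !gluer => -[].
Qed.

(** * The coproduct as a sum over splittings *)

Lemma mcoeff_tensor (K L : choiceType) (u : free K) (v : free L) (k : K) (l : L) :
  (tensor u v)@_((k, l) : K ** L) = u@_k * v@_l.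
Proof.
elim/free_ind: u => [|a u w IH IH'|i].
- by rewrite tensor0l !mcoeff0 mul0r.
- by rewrite tensorDl !mcoeffD !mcoeffZ IH IH' mulrDl mulrA.
elim/free_ind: v => [|a v w IH IH'|j].
- by rewrite tensor0r !mcoeff0 mulr0.
- by rewrite tensorDr !mcoeffD !mcoeffZ IH IH' mulrDr mulrCA.
by rewrite tensorU !genE -natrM mulnb -xpair_eqE.
Qed.

(** Coefficients of composite linear maps are sums over a support; here such a sum collapses to its
    only possible nonzero term. If [k] is outside the support, both sides are 0. *)
Lemma lin_ext_mcoeff (K : choiceType) (f : K -> rat) (k : K) (u : free K) :
  (forall j, u@_j != 0 -> j != k -> f j = 0) ->
  lin_ext (fun j => f j : rat^o) u = u@_k * f k.
Proof.
move=> f0; rewrite lin_extE; have [ku|ku] := boolP (k \in msupp u).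
  rewrite (bigD1_seq k) ?fset_uniq //= big_seq_cond big1 ?addr0 // => j /andP[ju jk].
  by rewrite f0 ?scaler0 // mcoeff_neq0.
rewrite mcoeff_outdom // mul0r big_seq big1 // => j ju.
rewrite f0 ?scaler0 ?mcoeff_neq0 //; apply: contraNneq ku => <-; exact: ju.
Qed.

Lemma mcoeff_lin_ext (K L : choiceType) (f : K -> free L) (u : free K) (l : L) :
  (lin_ext f u)@_l = lin_ext (fun k => (f k)@_l : rat^o) u.
Proof.
elim/free_ind: u => [|a u v IH IH'|k].
- by rewrite !linear0 mcoeff0.
- by rewrite !linearP mcoeffD mcoeffZ /= IH IH'.
by rewrite !lin_extU.
Qed.

Lemma hmul2_suml (K : choiceType) (m : {linear free (K ** K) -> free K})
    (I : Type) (r : seq I) (P : pred I) F v :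
  hmul2 m (\sum_(i <- r | P i) F i) v = \sum_(i <- r | P i) hmul2 m (F i) v.
Proof.
apply: (big_morph (fun u => hmul2 m u v)) => [x y|]; last exact: hmul20l.
by rewrite -[x in LHS]scale1r hmul2Dl scale1r.
Qed.

Lemma hmul2_sumr (K : choiceType) (m : {linear free (K ** K) -> free K})
    (I : Type) (r : seq I) (P : pred I) F v :
  hmul2 m v (\sum_(i <- r | P i) F i) = \sum_(i <- r | P i) hmul2 m v (F i).
Proof.
apply: (big_morph (fun u => hmul2 m v u)) => [x y|]; last exact: hmul20r.
by rewrite -[x in LHS]scale1r hmul2Dr scale1r.
Qed.

Definition comul_closed (s : sgraph) : QGG := \sum_(A : {set s} | edge_closed A)
  gen ((class (induced A), class (induced (~: A))) : graph ** graph).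

Lemma comul_closed_iso s t : isomorphic s t -> comul_closed s = comul_closed t.
Proof.
move=> /isomorphicE[f fI]; have /IsoP[fi fs fe] := fI.
have [g [_ fK gK]] := Iso_inv fI.
have cf (A : {set t}) : class (induced (f @^-1: A)) = class (induced A).
  rewrite -(induced_emb fi fe); congr (class (induced _)).
  apply/setP => y; apply/imsetP/idP => [[x]|yA]; first by rewrite inE => xA ->.
  by exists (g y); rewrite ?inE gK.
have fB : {on [pred A : {set s} | edge_closed A], bijective (fun A : {set t} => f @^-1: A)}.
  exists (fun A : {set s} => g @^-1: A) => A _; apply/setP => x; by rewrite !inE ?fK ?gK.
rewrite /comul_closed (reindex _ fB); apply: eq_big => A.
  apply/edge_closedP/edge_closedP => cA x y; last by rewrite -fe !inE; apply: cA.
  by rewrite -{1}(gK x) -{1}(gK y) fe => /cA; rewrite !inE !gK.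
by move=> _; rewrite -preimsetC !cf.
Qed.

(** A vertex set of the union is a pair of vertex sets, it is edge-closed exactly when both parts
    are, and its induced graph is the union of the two induced graphs; so the sum factors. *)
Lemma comul_closed_union s t : comul_closed (disjoint_union s t) =
  hmul2 mul_hom (comul_closed s) (comul_closed t).
Proof.
pose il (x : s) : disjoint_union s t := inl x.
pose ir (x : t) : disjoint_union s t := inr x.
have cU (C : {set disjoint_union s t}) : class (induced C) =
    gunion (class (induced (il @^-1: C))) (class (induced (ir @^-1: C))).
  rewrite gunion_class; apply/esym/classP/isomorphicP.
  have lP (x : induced (il @^-1: C)) : il (val x) \in C by have := valP x; rewrite inE.
  have rP (x : induced (ir @^-1: C)) : ir (val x) \in C by have := valP x; rewrite inE.
  pose F (x : induced (il @^-1: C) + induced (ir @^-1: C)) : induced C :=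
    match x with inl x => exist _ (il (val x)) (lP x)
    | inr x => exist _ (ir (val x)) (rP x) end.
  exists F.
  split; last by move=> [x|x] [y|y].
    by move=> [x|x] [y|y] [] // /val_inj ->.
  move=> [[x|x] xC].
    have xC' : x \in il @^-1: C by rewrite inE.
    by exists (inl (exist _ x xC')); apply: val_inj.
  have xC' : x \in ir @^-1: C by rewrite inE.
  by exists (inr (exist _ x xC')); apply: val_inj.
have eU (C : {set disjoint_union s t}) :
    edge_closed C = edge_closed (il @^-1: C) && edge_closed (ir @^-1: C).
  apply/edge_closedP/andP => [cC|[/edge_closedP cl /edge_closedP cr] [x|x] [y|y] //].
  - by split; apply/edge_closedP => x y xy; rewrite !inE; apply: cC.
  - by move/(cl x y); rewrite !inE.
  - by move/(cr x y); rewrite !inE.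
rewrite hmul2_suml; under [RHS]eq_bigr => A _ do rewrite hmul2_sumr.
pose h (p : {set s} * {set t}) : {set disjoint_union s t} :=
  [set x | match x with inl y => y \in p.1 | inr y => y \in p.2 end].
have hl p : il @^-1: h p = p.1 by apply/setP => x; rewrite !inE.
have hr p : ir @^-1: h p = p.2 by apply/setP => x; rewrite !inE.
have hB : {on [pred C | edge_closed C], bijective h}.
  exists (fun C : {set disjoint_union s t} => (il @^-1: C, ir @^-1: C)) => [[A B] _|C _].
    by rewrite hl hr.
  by apply/setP => -[x|x]; rewrite !inE.
rewrite pair_big /= /comul_closed (reindex _ hB); apply: eq_big => -[A B].
  by rewrite eU hl hr.
by move=> _; rewrite tmU /= 2!cU !preimsetC hl hr.
Qed.

Lemma connected_edge_closed (s : sgraph) (A : {set s}) :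
  connected s -> edge_closed A = (A == set0) || (A == [set: s]).
Proof.
case/andP => _ /forallP sc; apply/edge_closedP/orP => [cA|[]/eqP-> x y _].
- have [->|[x xA]] := set_0Vmem A; [by left|right; apply/eqP/setP => y].
  rewrite inE; have /forallP/(_ y)/connectP[p] := sc x.
  elim: p x xA => [|z p IH] x xA /=; first by move=> _ ->.
  by case/andP=> /cA xz; apply: IH; rewrite -xz.
- by rewrite !inE.
- by rewrite !inE.
Qed.

Lemma class_induced0 (s : sgraph) : class (induced (set0 : {set s})) = empty_graph.
Proof.
have no (x : induced (set0 : {set s})) : False by have := valP x; rewrite inE.
apply/classP/isomorphicP; exists (fun x => match no x with end).
by split=> [x|[]|x]; case: (no x).
Qed.

Lemma class_inducedT (s : sgraph) : class (induced [set: s]) = class s.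
Proof.
apply/classP/isomorphicP; exists val; split=> //; first exact: val_inj.
by move=> y; exists (exist _ y (in_setT y)).
Qed.

Lemma comul_closed_connected s : connected s -> comul_closed s =
  tensor (gen (class s)) unit_graph + tensor unit_graph (gen (class s)).
Proof.
move=> sc; rewrite /comul_closed (bigD1 [set: s]) ?connected_edge_closed ?eqxx ?orbT //=.
rewrite (big_pred1 set0) /=.
  by rewrite setCT setC0 class_induced0 class_inducedT !tensorU.
move=> A; rewrite connected_edge_closed // -[RHS]/(A == set0).
have [->|_] := eqVneq A set0; last by rewrite orFb andbN.
  (* A connected graph has a vertex, so the empty set differs from the full vertex set and the two
     terms are distinct. *)
  rewrite orTb andTb; case/andP: sc => /card_gt0P[x _] _; apply/eqP => /setP/(_ x).
  by rewrite !inE.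
Qed.

Lemma comul_closed_empty : comul_closed empty_sgraph = tensor unit_graph unit_graph.
Proof.
have E (A : {set empty_sgraph}) : A = set0 by apply/setP => -[].
rewrite /comul_closed (big_pred1 set0) => [|A].
  by rewrite [~: _]E class_induced0 tensorU.
by rewrite -[RHS]/(A == set0) [A]E eqxx; apply/edge_closedP => -[].
Qed.

(* The coproduct of a graph with [n] components sums over the [2 ^ n] ways of
   splitting its vertex set into two parts with no edge between them. *)
Lemma comul_hom'_closed s : comul_hom' (gen (class s)) = comul_closed s.
Proof.
pose D : {linear QG -> QGG} := lin_ext (fun t : graph => comul_closed (rep t)).
have DE t : D (gen (class t)) = comul_closed t.
  by rewrite /D /= lin_extU; apply/comul_closed_iso/rep_class.
(* It suffices that [D] is unital, multiplicative and primitive on connected graphs. *)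
rewrite -DE; apply/esym/comul_hom'_unique => [|u v|t tc].
- by rewrite DE comul_closed_empty.
- elim/free_ind: u => [|a u u' IH IH'|k].
  + by rewrite tensor0l !linear0 hmul20l.
  + by rewrite tensorDl !linearP hmul2Dl IH IH'.
  elim/free_ind: v => [|a v v' IH IH'|l].
  + by rewrite tensor0r !linear0 hmul20r.
  + by rewrite tensorDr !linearP hmul2Dr IH IH'.
  rewrite tensorU mul_homU DE comul_closed_union -!DE !class_rep //.
- by rewrite DE comul_closed_connected.
Qed.

Lemma class_eqE (s : sgraph) (g : graph) : (class s == g) = isomorphic s (rep g).
Proof. by rewrite -{1}(class_rep g); apply/eqP/classP. Qed.

(** The isomorphisms from [t] to the union of [a] and [b] are counted twice. They number
    [#|Aut (rep t)|] or 0; sorted by the preimage [A] of [a], each splitting of type [(a, b)]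
    contributes [#|Aut (rep a)|] times [#|Aut (rep b)|]. *)
Lemma mcoeff_comul_hom' (t a b : graph) :
  (comul_hom' (gen t))@_((a, b) : graph ** graph) =
  (gunion a b == t)%:R * (#|Aut (rep t)|%:R / (#|Aut (rep a)|%:R * #|Aut (rep b)|%:R)).
Proof.
have A0 : #|Aut (rep a)|%:R * #|Aut (rep b)|%:R != 0 :> rat by rewrite mulf_neq0 ?Aut_neq0.
rewrite mulrA; apply: (canRL (mulfK A0)).
have -> : (gunion a b == t)%:R * #|Aut (rep t)|%:R =
    #|Iso (rep t) (disjoint_union (rep a) (rep b))|%:R :> rat.
  by rewrite card_Iso natrM isomorphic_sym -class_eqE.
rewrite (card_glue (X := Iso)); last by move=> *; apply: glue_Iso.
rewrite -[t in gen t]class_rep comul_hom'_closed raddf_sum /= mulr_suml natr_sum.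
apply: eq_bigr => A _; rewrite -tensorU mcoeff_tensor !genE !class_eqE.
rewrite [#|Iso (induced A) _|]card_Iso [#|Iso (induced (~: A)) _|]card_Iso.
rewrite !natrM; case: (boolP (isomorphic _ _)) => [i1|_]; last by rewrite !mul0r.
case: (boolP (isomorphic _ _)) => [i2|_]; last by rewrite !(mul0r, mulr0).
by rewrite (card_Aut_iso i1) (card_Aut_iso i2) !mul1r.
Qed.

Lemma mcoeff_comul_hom'_lin (u : QG) (a b : graph) :
  (comul_hom' u)@_((a, b) : graph ** graph) = u@_(gunion a b) *
    (#|Aut (rep (gunion a b))|%:R / (#|Aut (rep a)|%:R * #|Aut (rep b)|%:R)).
Proof.
elim/free_ind: u => [|c u v IH IH'|t].
- by rewrite linear0 !mcoeff0 mul0r.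
- by rewrite linearP !mcoeffD !mcoeffZ IH IH' mulrDl !mulrA.
by rewrite mcoeff_comul_hom' genE eq_sym; case: eqP => [->|]; rewrite ?mul0r.
Qed.

(** * The Hopf algebra of disjoint unions *)

Lemma card_eq_empty (g : graph) : (#|rep g| == 0%N) = (g == empty_graph).
Proof.
apply/eqP/eqP => [g0|->]; last by rewrite card_class card_void.
rewrite -[g]class_rep; apply/classP/isomorphicP.
have no (x : rep g) : False by have := fintype0 x g0.
by exists (fun x => match no x with end); split=> [x|[]|x]; case: (no x).
Qed.

Lemma gunion_eq_empty (a b : graph) :
  (gunion a b == empty_graph) = (a == empty_graph) && (b == empty_graph).
Proof. by rewrite -!card_eq_empty card_gunion addn_eq0. Qed.

Lemma counit_graphE (u : QG) : (counit_graph u : rat) = u@_empty_graph.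
Proof.
rewrite /counit_graph /= (lin_ext_mcoeff (k := empty_graph)); last by move=> j _ /negbTE ->.
by rewrite eqxx mulr1.
Qed.

Lemma card_Aut_empty : #|Aut (rep empty_graph)| = 1%N.
Proof.
rewrite card_Aut_class; apply/eqP; rewrite eqn_leq Aut_gt0 andbT.
by apply: leq_trans (max_card _) _; rewrite card_ffun card_void.
Qed.

Lemma mul_hom_alg : is_algebra (graph_hopf mul_hom comul_hom').
Proof.
split=> [a b c|] /=.
  elim/free_ind: a => [|x a a' IH IH'|a]; first by rewrite !(tensor0l, linear0).
    by rewrite !(tensorDl, linearP) /= IH IH'.
  elim/free_ind: b => [|x b b' IH IH'|b]; first by rewrite !(tensor0l, tensor0r, linear0).
    by rewrite !(tensorDl, tensorDr, linearP) /= IH IH'.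
  elim/free_ind: c => [|x c c' IH IH'|c]; first by rewrite !(tensor0r, linear0).
    by rewrite !(tensorDr, linearP) /= IH IH'.
  by rewrite !(tensorU, mul_homU) gunionA.
split; elim/free_ind => [|x a a' IH IH'|a].
- by rewrite !(tensor0r, linear0).
- by rewrite !(tensorDr, linearP) /= IH IH'.
- by rewrite tensorU mul_homU gunion1.
- by rewrite !(tensor0l, linear0).
- by rewrite !(tensorDl, linearP) /= IH IH'.
- by rewrite tensorU mul_homU gunionC gunion1.
Qed.

Lemma mcoeff_tensor_assoc (u : free (graph ** graph ** graph)) (a b c : graph) :
  (tensor_assoc u)@_((a, (b, c)) : graph ** (graph ** graph)) =
  u@_((a, b, c) : graph ** graph ** graph).
Proof.
elim/free_ind: u => [|x u v IH IH'|[[a' b'] c']].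
- by rewrite linear0 !mcoeff0.
- by rewrite linearP !mcoeffD !mcoeffZ IH IH'.
by rewrite -!tensorU tensor_assocE !mcoeff_tensor mulrA.
Qed.

(** At [(a, b, c)] each side of coassociativity has one contributing pair, [(gunion a b, c)] or
    [(a, gunion b c)]. The automorphism counts of the intermediate union cancel, leaving a formula
    symmetric in the bracketing. *)
Lemma comul_hom'_coalg : is_coalgebra (graph_hopf mul_hom comul_hom').
Proof.
split=> [u|] /=.
  apply/malgP => -[a [b c]]; rewrite mcoeff_tensor_assoc /tensor_map !mcoeff_lin_ext.
  rewrite (lin_ext_mcoeff (k := ((gunion a b, c) : graph ** graph))); last first.
    case=> d e _ /=; rewrite xpair_eqE negb_and mcoeff_tensor genE.
    case: (eqVneq e c) => [_|_ _]; last by rewrite mulr0.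
    by rewrite orbF mcoeff_comul_hom' eq_sym => /negbTE ->; rewrite !mul0r.
  rewrite (lin_ext_mcoeff (k := ((a, gunion b c) : graph ** graph))); last first.
    case=> d e _ /=; rewrite xpair_eqE negb_and mcoeff_tensor genE.
    case: (eqVneq d a) => [_|_ _]; last by rewrite mul0r.
    by rewrite orFb mcoeff_comul_hom' eq_sym => /negbTE ->; rewrite mul0r mulr0.
  rewrite !mcoeff_tensor !mcoeff_comul_hom'_lin !genE !eqxx gunionA !mul1r !mulr1.
  by field; rewrite !Aut_neq0.
split=> u; apply/malgP => a; rewrite mcoeff_lin_ext.
  rewrite (lin_ext_mcoeff (k := ((empty_graph, a) : graph ** graph))); last first.
    case=> d e _ /=; rewrite xpair_eqE negb_and mcoeffZ !counit_graphE !genE.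
    by case: eqP => //=; case: eqP => //; rewrite ?(mul0r, mulr0).
  rewrite mcoeffZ counit_graphE !genE !eqxx !mulr1 mcoeff_comul_hom'_lin gunion1.
  by rewrite card_Aut_empty mul1r divff ?mulr1 // Aut_neq0.
rewrite (lin_ext_mcoeff (k := ((a, empty_graph) : graph ** graph))); last first.
  case=> d e _ /=; rewrite xpair_eqE negb_and mcoeffZ !counit_graphE !genE.
  by case: eqP => //=; case: eqP => //; rewrite ?(mul0r, mulr0).
rewrite mcoeffZ counit_graphE !genE !eqxx !mulr1 mcoeff_comul_hom'_lin gunionC gunion1.
by rewrite card_Aut_empty mulr1 divff ?mulr1 // Aut_neq0.
Qed.

(** The component of some vertex is split off, and the rest has fewer vertices. *)
Lemma graph_ind (P : graph -> Prop) :
  P empty_graph -> (forall s, connected s -> P (class s)) ->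
  (forall a b, P a -> P b -> P (gunion a b)) -> forall g, P g.
Proof.
move=> P0 Pc PU g; rewrite -(class_rep g); move: (rep g) => {g} s.
have [n] := ubnP #|s|; elim: n s => // n IH s sn.
have [s0|/card_gt0P[x _]] := posnP #|s|.
  suff -> : class s = empty_graph by [].
  have no (x : s) : False by have := fintype0 x s0.
  apply/classP/isomorphicP; exists (fun x => match no x with end).
  by split=> [x|[]|x]; case: (no x).
have -> : class s = gunion (class (induced (component x)))
    (class (induced (~: component x))).
  by rewrite gunion_class; apply/esym/classP/iso_component_split.
apply: PU; first exact/Pc/connected_component.
apply: IH; rewrite card_sig (eq_card (B := ~: component x)) // cardsCs setCK.
rewrite -ltnS; apply: leq_trans sn; rewrite ltnS ltn_subrL.
by apply/andP; split; apply/card_gt0P; exists x; rewrite // inE connect0.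
Qed.

Definition ncomp (g : graph) : nat := #|components (rep g)|.

Lemma card_imc (s t : sgraph) (f : s -> t) : injective f -> #|imc f| = #|components s|.
Proof. by move=> fi; rewrite card_imset //; apply: imset_inj. Qed.

Lemma ncomp_class s : ncomp (class s) = #|components s|.
Proof.
have /isomorphicP[f [fi fs fe]] := rep_class s.
have fc x y : edge (f x) y -> exists z, y = f z.
  by move=> _; have [z <-] := fs y; exists z.
rewrite /ncomp -(card_imc fi) imcE //; apply: eq_card => C.
apply/imsetP/imsetP => -[x _ ->]; first by exists (f x).
by have [y <-] := fs x; exists y.
Qed.

Lemma ncomp_gunion a b : ncomp (gunion a b) = (ncomp a + ncomp b)%N.
Proof.
pose s := rep a; pose t := rep b; rewrite [LHS]ncomp_class.
have il : injective (inl : s -> disjoint_union s t) by move=> x y [].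
have ir : injective (inr : t -> disjoint_union s t) by move=> x y [].
have cl (x : s) (y : disjoint_union s t) : edge (inl x : disjoint_union s t) y ->
    exists z, y = inl z by case: y => // y _; exists y.
have cr (x : t) (y : disjoint_union s t) : edge (inr x : disjoint_union s t) y ->
    exists z, y = inr z by case: y => // y _; exists y.
have -> : components (disjoint_union s t) =
    imc (inl : s -> disjoint_union s t) :|: imc (inr : t -> disjoint_union s t).
  apply/setP => C; rewrite inE !imcE //.
  apply/imsetP/orP => [[[x|x] _ ->]|]; first by left; apply/imsetP; exists x.
    by right; apply/imsetP; exists x.
  by case=> /imsetP[x _ ->]; [exists (inl x) | exists (inr x)].
rewrite cardsU !card_imc // (_ : _ :&: _ = set0) ?cards0 ?subn0 //.
apply/setP => C; rewrite !imcE // !inE; apply/negP => /andP[/imsetP[x _ ->]].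
case/imsetP=> y _ /setP/(_ (inl x)).
by rewrite [in RHS]component_emb // inE connect0 => /esym/imsetP[].
Qed.

Lemma ncomp_connected s : connected s -> ncomp (class s) = 1%N.
Proof.
case/andP=> /card_gt0P[x _] /forallP sc; rewrite ncomp_class.
have cT y : component y = [set: s].
  by apply/setP => z; rewrite !inE; have /forallP := sc y; apply.
rewrite -(cards1 [set: s]); apply: eq_card => C; rewrite inE.
by apply/imsetP/eqP => [[y _ ->]|->]; [|exists x].
Qed.

Lemma ncomp_empty : ncomp empty_graph = 0%N.
Proof. by rewrite ncomp_class; apply/eqP; rewrite cards_eq0 imset_eq0; apply/set0Pn => -[[]]. Qed.

(** Connected graphs are primitive, so an antipode is minus the identity on them; extended
    multiplicatively, it contributes one sign per component. *)
Definition antipode_hom : {linear QG -> QG} :=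
  lin_ext (fun g : graph => (-1) ^+ ncomp g *: gen g).

(** The convolution of two algebra morphisms is again multiplicative when the product is
    commutative, since the two middle factors may be exchanged. *)
Lemma tensor_map_hmul2 (f g : {linear QG -> QG}) x y :
  (forall a b, f (gen (gunion a b)) = mul_hom (tensor (f (gen a)) (f (gen b)))) ->
  (forall a b, g (gen (gunion a b)) = mul_hom (tensor (g (gen a)) (g (gen b)))) ->
  mul_hom (tensor_map f g (hmul2 mul_hom x y)) =
  mul_hom (tensor (mul_hom (tensor_map f g x)) (mul_hom (tensor_map f g y))).
Proof.
have [mA _] := mul_hom_alg.
have mC u v : mul_hom (tensor u v) = mul_hom (tensor v u).
  elim/free_ind: u => [|a u u' IH IH'|k].
  - by rewrite !(tensor0l, tensor0r, linear0).
  - by rewrite !(tensorDl, tensorDr, linearP) /= IH IH'.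
  elim/free_ind: v => [|a v v' IH IH'|l].
  - by rewrite !(tensor0l, tensor0r, linear0).
  - by rewrite !(tensorDl, tensorDr, linearP) /= IH IH'.
  by rewrite !tensorU !mul_homU gunionC.
move=> fM gM; elim/free_ind: x => [|a x x' IH IH'|[a b]].
- by rewrite hmul20l !linear0 tensor0l linear0.
- by rewrite hmul2Dl !linearP /= tensorDl linearP IH IH'.
elim/free_ind: y => [|c y y' IH IH'|[c d]].
- by rewrite hmul20r !linear0.
- by rewrite hmul2Dr !linearP /= IH IH'.
rewrite tmU -!tensorU !tensor_mapE /= fM gM -!mA; congr (mul_hom (tensor _ _)).
by rewrite !mA (mC (f _)).
Qed.

Lemma antipode_homP : is_antipode (graph_hopf mul_hom comul_hom') antipode_hom.
Proof.
have SE g : antipode_hom (gen g) = (-1) ^+ ncomp g *: gen g by rewrite /antipode_hom /= lin_extU.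
have SM a b : antipode_hom (gen (gunion a b)) =
    mul_hom (tensor (antipode_hom (gen a)) (antipode_hom (gen b))).
  rewrite !SE tensorZl tensorZr !linearZ /= tensorU mul_homU ncomp_gunion.
  by rewrite exprD scalerA.
have IM a b : @idfun QG (gen (gunion a b)) = mul_hom (tensor (idfun (gen a)) (idfun (gen b))).
  by rewrite tensorU mul_homU.
have S1 : antipode_hom unit_graph = unit_graph by rewrite SE ncomp_empty expr0 scale1r.
have e1 : counit_graph unit_graph = 1 :> rat by rewrite counit_graphE genE eqxx.
have [_ [m1l m1r]] := mul_hom_alg.
(* Both antipode laws at once. Each side is multiplicative in [u], so induction over disjoint unions
   reduces to connected graphs, where the coproduct is primitive and the convolution is [f + g]. *)
have J (f g : {linear QG -> QG}) :
    (forall a b, f (gen (gunion a b)) = mul_hom (tensor (f (gen a)) (f (gen b)))) ->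
    (forall a b, g (gen (gunion a b)) = mul_hom (tensor (g (gen a)) (g (gen b)))) ->
    f unit_graph = unit_graph -> g unit_graph = unit_graph ->
    (forall s, connected s -> f (gen (class s)) + g (gen (class s)) = 0) ->
    forall u, mul_hom (tensor_map f g (comul_hom' u)) = (counit_graph u : rat) *: unit_graph.
  move=> fM gM f1 g1 fg; elim/free_ind => [|a u v IH IH'|t].
  - by rewrite !linear0 scale0r.
  - by rewrite !linearP /= IH IH' scalerDl scalerA.
  elim/graph_ind: t => [|s sc|a b IHa IHb].
  - rewrite comul_hom'1 tensor_mapE f1 g1 e1 scale1r; exact: m1l.
  - rewrite comul_hom'_connected // linearD /= !tensor_mapE f1 g1 linearD /=.
    rewrite [X in X + _]m1r [X in _ + X]m1l fg // counit_graphE genE.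
    case: eqP => [ce|_]; last by rewrite scale0r.
    by have := ncomp_connected sc; rewrite ce ncomp_empty.
  - rewrite -mul_homU -tensorU comul_hom'M tensor_map_hmul2 // IHa IHb.
    rewrite tensorZl tensorZr !linearZ /= [mul_hom (tensor unit_graph _)]m1l scalerA.
    rewrite tensorU mul_homU !counit_graphE !genE gunion_eq_empty.
    by rewrite -natrM mulnb.
have Sc s : connected s -> antipode_hom (gen (class s)) = - gen (class s).
  by move=> sc; rewrite SE ncomp_connected // expr1 scaleN1r.
move=> u; split; apply: J => //.
- by move=> s sc; rewrite Sc // addNr.
- by move=> s sc; rewrite Sc // addrN.
Qed.

Lemma hom_hopf : is_hopf_algebra (graph_hopf mul_hom comul_hom').
Proof.
split; last by exists antipode_hom; apply: antipode_homP.
split; first exact: mul_hom_alg.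
split; first exact: comul_hom'_coalg.
split; first exact: comul_hom'M.
split; first exact: comul_hom'1.
split; last by rewrite [LHS]counit_graphE genE eqxx.
move=> u v /=; elim/free_ind: u => [|a u u' IH IH'|k].
- by rewrite tensor0l !linear0 mul0r.
- by rewrite tensorDl !linearP /= IH IH' mulrDl -mulrA.
elim/free_ind: v => [|a v v' IH IH'|l].
- by rewrite tensor0r !linear0 mulr0.
- by rewrite tensorDr !linearP /= IH IH' mulrDr mulrCA.
by rewrite tensorU mul_homU !counit_graphE !genE gunion_eq_empty -natrM mulnb.
Qed.

(** * Triangularity *)

Section Triangular.
Variables (K : choiceType) (N : K -> nat) (phi : K -> free K).
Hypothesis phi_diag : forall k, (phi k)@_k != 0.
Hypothesis phi_lower : forall k j, (phi k)@_j != 0 -> j != k -> (N j < N k)%N.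

(** By induction on [N k]: [phi k] is a nonzero multiple of [gen k] plus terms of smaller [N], which
    already lie in the image. *)
Lemma triangular_surjective v : exists u, lin_ext phi u = v.
Proof.
have Im0 : exists u, lin_ext phi u = 0 by exists 0; rewrite linear0.
have ImP a v1 v2 : (exists u, lin_ext phi u = v1) -> (exists u, lin_ext phi u = v2) ->
    exists u, lin_ext phi u = a *: v1 + v2.
  by move=> [u1 <-] [u2 <-]; exists (a *: u1 + u2); rewrite linearP.
elim/free_ind: v => [|a v1 v2 H1 H2|k]; [exact: Im0|exact: ImP|].
have [n] := ubnP (N k); elim: n k => // n IH k kn.
pose r := \sum_(j <- msupp (phi k) | j != k) (phi k)@_j *: gen j.
have [u ur] : exists u, lin_ext phi u = r.
  rewrite /r big_seq_cond; elim/big_rec: _ => [|j x /andP[jk nk] IHx]; first exact: Im0.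
  apply: ImP => //; apply: IH; move: kn; rewrite ltnS.
  by apply: leq_trans; apply: phi_lower; rewrite ?mcoeff_neq0.
have phiE : phi k = (phi k)@_k *: gen k + r.
  by rewrite {1}[phi k]free_genE (bigD1_seq k) ?fset_uniq //= -mcoeff_neq0.
exists (((phi k)@_k)^-1 *: (gen k - u)).
by rewrite linearZ linearB /= lin_extU ur {2}phiE addrK scalerA mulVf ?scale1r.
Qed.

(** Coefficients of a kernel element vanish from the largest [N] downwards: at coordinate [k], apart
    from [k] itself, only indices with larger [N] can contribute. *)
Lemma triangular_injective : injective (lin_ext phi).
Proof.
(* [M] bounds [N] on the support, so the descent becomes an induction on [M - N k]. *)
apply: raddf_inj => u u0; pose M := (\max_(k <- msupp u) N k)%N.
have uM k : u@_k != 0 -> (N k <= M)%N.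
  by rewrite mcoeff_neq0 => ku; rewrite /M (big_rem k) //= leq_maxl.
apply/malgP => k; rewrite mcoeff0.
have [n] := ubnP (M - N k); elim: n k => // n IH k kn.
have := congr1 (mcoeff k) u0; rewrite mcoeff0 mcoeff_lin_ext.
rewrite (lin_ext_mcoeff (k := k)) => [/eqP|j uj jk].
  by rewrite mulf_eq0 (negbTE (phi_diag k)) orbF => /eqP.
have [//|pjk] := eqVneq (phi j)@_k 0.
have Nkj : (N k < N j)%N by apply: phi_lower; rewrite // eq_sym.
case/eqP: (uj); apply: IH; move: kn; rewrite ltnS; apply: leq_trans.
by apply: ltn_sub2l => //; apply: leq_trans Nkj (uM _ uj).
Qed.

Lemma triangular_bijective : bijective (lin_ext phi).
Proof.
have /boolp.choice[g gK] := triangular_surjective.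
by exists g => // u; apply: triangular_injective; rewrite gK.
Qed.
End Triangular.

(** * Sizes that detect isomorphisms *)

Section Measures.
Variables (s t : sgraph).
Implicit Types f : {ffun s -> t}.

(** Neither summand can decrease along a monomorphism, so equality of the sums forces equality of
    both. Edges are counted as ordered pairs. *)
Definition mono_size (s : sgraph) : nat := (#|s| + #|[set p : s * s | edge p.1 p.2]|)%N.

(** Ordered pairs, with the diagonal included because there are no loops; the diagonal is how this
    set also controls the vertices. *)
Definition non_edges (s : sgraph) : {set s * s} := [set p | ~~ edge p.1 p.2].

Lemma Mono_eq_size f : f \in Mono s t -> (mono_size t <= mono_size s)%N -> isomorphic s t.
Proof.
move=> /MonoP[/HomP fh fi] ts.
pose es := [set p : s * s | edge p.1 p.2]; pose et := [set p : t * t | edge p.1 p.2].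
pose F (p : s * s) := (f p.1, f p.2).
have Fi : injective F by move=> [x y] [x' y'] [/fi -> /fi ->].
have sub : F @: es \subset et by apply/subsetP => _ /imsetP[p + ->]; rewrite !inE; apply: fh.
have le1 : (#|s| <= #|t|)%N := leq_card f fi.
have le2 : (#|es| <= #|et|)%N by rewrite -(card_imset _ Fi); apply: subset_leq_card.
have ge1 : (#|t| <= #|s|)%N.
  by rewrite -(leq_add2r #|es|); apply: leq_trans (leq_add (leqnn _) le2) ts.
have ge2 : (#|et| <= #|es|)%N.
  by rewrite -(leq_add2l #|s|); apply: leq_trans (leq_add le1 (leqnn _)) ts.
have /eqP eF : F @: es == et by rewrite eqEcard sub card_imset.
have [g fK gK] := inj_card_bij fi ge1.
apply/isomorphicP; exists f; split=> // [y|x y]; first by exists (g y).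
apply/idP/idP => [fxy|]; last exact: fh.
have : (f x, f y) \in et by rewrite inE.
by rewrite -eF => /imsetP[[x' y'] + [/fi -> /fi ->]]; rewrite inE.
Qed.

(** A choice of preimages keeps non-adjacent pairs non-adjacent because [f] preserves edges; hence
    an epimorphism cannot increase their number. *)
Lemma Epi_section f : f \in Epi s t -> exists g : t -> s,
  cancel g f /\ [set (g p.1, g p.2) | p in non_edges t] \subset non_edges s.
Proof.
move=> /EpiP[/HomP fh /boolp.choice[g gK]]; exists g; split=> //.
apply/subsetP => _ /imsetP[p + ->]; rewrite !inE /=; apply: contraNN => /fh.
by rewrite !gK.
Qed.

Lemma card_section (g : t -> s) f : cancel g f ->
  #|[set (g p.1, g p.2) | p in non_edges t]| = #|non_edges t|.
Proof.
by move=> /can_inj gi; rewrite card_imset // => -[x y] [x' y'] [/gi -> /gi ->].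
Qed.

Lemma Epi_eq_non_edges f : f \in Epi s t -> (#|non_edges s| <= #|non_edges t|)%N ->
  isomorphic s t.
Proof.
move=> fE le; have [g [gK sub]] := Epi_section fE; have /EpiP[/HomP fh fs] := fE.
have /eqP eg : [set (g p.1, g p.2) | p in non_edges t] == non_edges s.
  by rewrite eqEcard sub (card_section gK).
(* The diagonal pair [(x, x)] is a non-edge, hence comes from the section, so [x] is a value of
   [g]. *)
have fK : cancel f g.
  move=> x; have : (x, x) \in non_edges s by rewrite inE edge_irr.
  by rewrite -eg => /imsetP[[y y'] _ [-> _]]; rewrite gK.
apply/isomorphicP; exists f; split=> // [|x y]; first exact: can_inj fK.
apply/idP/idP => [|/fh//]; apply: contraTT => xy.
have : (x, y) \in non_edges s by rewrite inE.
by rewrite -eg => /imsetP[[x' y'] + [-> ->]]; rewrite inE !gK.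
Qed.
End Measures.

(** * Factorization systems *)

Notation morphism_class := (forall s t : sgraph, {set {ffun s -> t}}).

(** An orthogonal factorization system with its uniqueness up to isomorphism. The comparison [p]
    also satisfies [p e = e'], because [m'] is injective. *)
Record factorization_system (L R : morphism_class) : Prop := {
  fact_Epi : forall s t : sgraph, L s t \subset Epi s t;
  fact_Mono : forall s t : sgraph, R s t \subset Mono s t;
  fact_Iso_epi : forall s t : sgraph, Iso s t \subset L s t;
  fact_Iso_mono : forall s t : sgraph, Iso s t \subset R s t;
  fact_comp_epi : forall (s t u : sgraph) (g : {ffun t -> u}) (f : {ffun s -> t}),
    g \in L t u -> f \in L s t -> comp_ffun g f \in L s u;
  fact_comp_mono : forall (s t u : sgraph) (g : {ffun t -> u}) (f : {ffun s -> t}),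
    g \in R t u -> f \in R s t -> comp_ffun g f \in R s u;
  fact_exists : forall (s u : sgraph) (f : {ffun s -> u}), f \in Hom s u ->
    exists (t : sgraph) (e : {ffun s -> t}) (m : {ffun t -> u}),
      [/\ e \in L s t, m \in R t u & f = comp_ffun m e];
  fact_unique : forall (s t t' u : sgraph) (e : {ffun s -> t}) (m : {ffun t -> u})
      (e' : {ffun s -> t'}) (m' : {ffun t' -> u}),
    e \in L s t -> m \in R t u -> e' \in L s t' -> m' \in R t' u ->
    comp_ffun m e = comp_ffun m' e' ->
    exists2 p : {ffun t -> t'}, p \in Iso t t' & m = comp_ffun m' p }.

(** Both middle sets are in bijection with the image of the common composite. *)
Lemma image_bijection (s t t' u : finType) (e : {ffun s -> t}) (m : {ffun t -> u})
    (e' : {ffun s -> t'}) (m' : {ffun t' -> u}) :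
  (forall y, exists x, e x = y) -> injective m ->
  (forall y, exists x, e' x = y) -> injective m' ->
  comp_ffun m e = comp_ffun m' e' ->
  exists p : {ffun t -> t'}, [/\ m = comp_ffun m' p, comp_ffun p e = e',
    injective p & forall z, exists y, p y = z].
Proof.
move=> es mi es' mi' /ffunP me.
have /boolp.choice[p pE] (y : t) : exists z, m y = m' z.
  by have [x <-] := es y; exists (e' x); have := me x; rewrite !ffunE.
have pe x : p (e x) = e' x by apply: mi'; rewrite -pE; have := me x; rewrite !ffunE.
exists [ffun y => p y]; split.
- by apply/ffunP => y; rewrite !ffunE.
- by apply/ffunP => x; rewrite !ffunE.
- by move=> y1 y2; rewrite !ffunE => p12; apply: mi; rewrite !pE p12.
- by move=> z; have [x <-] := es' z; exists (e x); rewrite ffunE.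
Qed.

Section RegularImage.
Variables (s u : sgraph) (f : {ffun s -> u}).

(** Only the edges of [u] coming from [s] are kept. The first conjunct makes the relation
    irreflexive for an arbitrary function [f]. *)
Definition image_edge (y1 y2 : {y | y \in f @: [set: s]}) : bool :=
  edge (val y1) (val y2) &&
  [exists x1, exists x2, [&& edge x1 x2, f x1 == val y1 & f x2 == val y2]].

Fact image_edge_sym : symmetric image_edge.
Proof.
have le y1 y2 : image_edge y1 y2 -> image_edge y2 y1.
  case/andP=> y12 /existsP[x1 /existsP[x2 /and3P[x12 e1 e2]]].
  rewrite /image_edge edge_sym y12; apply/existsP; exists x2; apply/existsP; exists x1.
  by rewrite edge_sym x12 e1 e2.
by move=> y1 y2; apply/idP/idP; apply: le.
Qed.

Fact image_edge_irr : irreflexive image_edge.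
Proof. by move=> y; rewrite /image_edge edge_irr. Qed.

Definition regular_image := SGraph image_edge_sym image_edge_irr.

Lemma mem_image x : f x \in f @: [set: s].
Proof. exact: imset_f. Qed.
End RegularImage.

Lemma RegEpi_Mono_system : factorization_system RegEpi Mono.
Proof.
split.
- exact: RegEpi_sub_Epi.
- by move=> s t; apply: subxx.
- exact: Iso_sub_RegEpi.
- by move=> s t; apply: subset_trans (Iso_sub_RegMono s t) (RegMono_sub_Mono s t).
- by move=> *; apply: RegEpi_comp.
- by move=> s t u g f gm fm; rewrite Mono_comp //; case/MonoP: fm.
- move=> s u f fh; have /HomP fh' := fh.
  exists (regular_image f), [ffun x => exist _ (f x) (mem_image f x)], [ffun y => val y].
  split; last by apply/ffunP => x; rewrite !ffunE.
    apply/RegEpiP; split; first apply/EpiP; first split.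
    + apply/HomP => x y xy; rewrite !ffunE /= /image_edge /= fh' //=.
      by apply/existsP; exists x; apply/existsP; exists y; rewrite xy !eqxx.
    + move=> [y yf]; have /imsetP[x _ yx] := yf; exists x; rewrite ffunE.
      by apply: val_inj.
    move=> y1 y2 /andP[_ /existsP[x1 /existsP[x2 /and3P[x12 /eqP e1 /eqP e2]]]].
    by exists x1, x2; split=> //; apply: val_inj; rewrite ffunE.
  apply/MonoP; split; last by move=> y1 y2; rewrite !ffunE => /val_inj.
  by apply/HomP => y1 y2; rewrite !ffunE => /andP[].
- move=> s t t' u e m e' m' /RegEpiP[/EpiP[/HomP eh es] er] /MonoP[mh mi].
  move=> /RegEpiP[/EpiP[/HomP eh' es'] er'] /MonoP[mh' mi'].
  case/(image_bijection es mi es' mi')=> p [mE /ffunP pe pi ps]; exists p => //.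
  have pE x : p (e x) = e' x by rewrite -pe ffunE.
  (* Every edge of either middle graph is the image of an edge of [s], so [p] preserves and reflects
     adjacency. *)
  apply/IsoP; split=> // y1 y2; apply/idP/idP => [/er'|/er] [x1 [x2 [x12]]].
    by rewrite -!pE => /pi <- /pi <-; apply: eh.
  by move=> <- <-; rewrite !pE; apply: eh'.
Qed.

Lemma Epi_RegMono_system : factorization_system Epi RegMono.
Proof.
split.
- by move=> s t; apply: subxx.
- exact: RegMono_sub_Mono.
- exact: Iso_sub_Epi.
- exact: Iso_sub_RegMono.
- by move=> *; apply: Epi_comp.
- by move=> s t u g f gm; rewrite RegMono_comp.
- move=> s u f /HomP fh.
  exists (induced (f @: [set: s])), [ffun x => exist _ (f x) (mem_image f x)], [ffun y => val y].
  split; last by apply/ffunP => x; rewrite !ffunE.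
    apply/EpiP; split; first by apply/HomP => x y xy; rewrite !ffunE; apply: fh.
    move=> [y yf]; have /imsetP[x _ yx] := yf; exists x; rewrite ffunE.
    by apply: val_inj.
  by apply/RegMonoP; split=> y1 y2; rewrite !ffunE // => /val_inj.
- move=> s t t' u e m e' m' /EpiP[_ es] /RegMonoP[mi me] /EpiP[_ es'] /RegMonoP[mi' me'].
  case/(image_bijection es mi es' mi')=> p [mE _ pi ps]; exists p => //.
  (* Adjacency in both middle graphs is read off in [u]. *)
  apply/IsoP; split=> // y1 y2.
  by rewrite -me' -[RHS]me mE !ffunE.
Qed.

(** * Counting embeddings into a test graph *)

Section Factorization.
Variables (L R : morphism_class).
Hypothesis LR : factorization_system L R.

Definition embeddings (u : sgraph) : {linear QG -> rat^o} :=
  lin_ext (fun g : graph => #|R (rep g) u|%:R : rat^o).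

Lemma embeddings_gen u g : embeddings u (gen g) = #|R (rep g) u|%:R.
Proof. by rewrite /embeddings /= lin_extU. Qed.

(* A pair [(e, m)] of composite [f] is determined by [m], and [m] runs over the
   isomorphisms of [t] onto the image of [f], precomposed with its inclusion. *)
Lemma card_factorizations (s t t0 u : sgraph) (e0 : {ffun s -> t0}) (m0 : {ffun t0 -> u}) :
  e0 \in L s t0 -> m0 \in R t0 u ->
  #|[set p : {ffun s -> t} * {ffun t -> u} | [&& p.1 \in L s t, p.2 \in R t u &
      comp_ffun p.2 p.1 == comp_ffun m0 e0]]| = #|Iso t t0|.
Proof.
move=> eL mR; have /MonoP[_ mi] := subsetP (fact_Mono LR _ _) _ mR.
set P := [set p | _].
rewrite -(card_in_imset (f := snd) (D := P)) => [|[e m] [e' m']].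
  rewrite -(card_imset (f := comp_ffun m0) (Iso t t0)) => [|p q /ffunP pq].
    apply: eq_card => m; apply/imsetP/imsetP => [[[e m'] + ->]|[p pI ->]].
      rewrite inE /= => /and3P[eL' mR' /eqP eq].
      by have [p pI ->] := fact_unique LR eL' mR' eL mR eq; exists p.
    have [q [qI pK qK]] := Iso_inv pI.
    exists (comp_ffun q e0, comp_ffun m0 p) => //; rewrite inE /=; apply/and3P; split.
    - by apply: (fact_comp_epi LR) => //; apply: subsetP qI; apply: (fact_Iso_epi LR).
    - by apply: (fact_comp_mono LR) => //; apply: subsetP pI; apply: (fact_Iso_mono LR).
    - by apply/eqP/ffunP => x; rewrite !ffunE qK.
  by apply/ffunP => y; have := pq y; rewrite !ffunE => /mi.
rewrite !inE /= => /and3P[_ mR1 /eqP eq] /and3P[_ _ /eqP eq'] mm; move: eq eq'; rewrite mm.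
move=> <- /ffunP eq; congr (_, _); apply/ffunP => x; have := eq x; rewrite !ffunE.
by rewrite mm in mR1; have /MonoP[_ mi'] := subsetP (fact_Mono LR _ _) _ mR1; move/mi'.
Qed.

Lemma fact_exists_rep (s u : sgraph) (f : {ffun s -> u}) : f \in Hom s u ->
  exists (g : graph) (e : {ffun s -> rep g}) (m : {ffun rep g -> u}),
    [/\ e \in L s (rep g), m \in R (rep g) u & f = comp_ffun m e].
Proof.
move=> /(fact_exists LR)[t [e [m [eL mR fE]]]].
have /isomorphicE[p pI] := rep_class t; have [q [qI pK qK]] := Iso_inv pI.
exists (class t), (comp_ffun q e), (comp_ffun m p); split.
- by apply: (fact_comp_epi LR) => //; apply: subsetP qI; apply: (fact_Iso_epi LR).
- by apply: (fact_comp_mono LR) => //; apply: subsetP pI; apply: (fact_Iso_mono LR).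
- by apply/ffunP => x; rewrite fE !ffunE qK.
Qed.

(** The central count. Each [f] in [F] factors through exactly one isomorphism class [g], in
    [#|Aut (rep g)|] ways, and [F] is recognised on the first factor by [E]. Dividing by
    automorphisms leaves each [f] counted once. *)
Lemma embeddings_factor (s u : sgraph) (F : {set {ffun s -> u}})
    (E : forall t : sgraph, {set {ffun s -> t}}) (v : QG) :
  F \subset Hom s u -> (forall t, E t \subset L s t) ->
  (forall (t : sgraph) (e : {ffun s -> t}) (m : {ffun t -> u}), e \in L s t -> m \in R t u ->
     (comp_ffun m e \in F) = (e \in E t)) ->
  (forall g, v@_g = #|E (rep g)|%:R / #|Aut (rep g)|%:R) ->
  embeddings u v = #|F|%:R.
Proof.
move=> /subsetP FH EL FE vE.
have /boolp.choice[im imE] (f : {ffun s -> u}) : exists g : graph, f \in F ->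
    exists (e : {ffun s -> rep g}) (m : {ffun rep g -> u}),
    [/\ e \in L s (rep g), m \in R (rep g) u & f = comp_ffun m e].
  (* Outside [F] the value [empty_graph] is only a default. *)
  have [fF|_] := boolP (f \in F); last by exists empty_graph.
  by have [g gE] := fact_exists_rep (FH _ fF); exists g.
(* Pairs [(e, m)] are sorted by their composite [f]; the fibre has the size of [Iso] from [rep g] to
   the image of [f], that is [#|Aut (rep g)|] or 0. *)
have count g : v@_g * #|R (rep g) u|%:R = \sum_(f in F) (im f == g)%:R.
  rewrite vE mulrAC; apply: (canLR (mulfK (Aut_neq0 (rep g)))).
  rewrite -natrM -cardsX -sum1_card mulr_suml.
  rewrite (partition_big (fun p => comp_ffun p.2 p.1) (mem F)) /=; last first.
    case=> e m; rewrite in_setX /= => /andP[eE mR].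
    by rewrite (FE _ e m) //; apply: subsetP eE; apply: EL.
  rewrite natr_sum; apply: eq_bigr => f fF.
  have [e0 [m0 [eL mR fE]]] := imE f fF.
  rewrite -natrM -(class_rep (im f)) class_eqE isomorphic_sym -card_Iso.
  rewrite -(card_factorizations _ eL mR) sum1dep_card -fE; congr _%:R.
  apply: eq_card => -[e m]; rewrite !inE /=.
  apply/andP/and3P => [[/andP[eE mR'] eq]|[eL' mR' eq]].
    by split=> //; apply: subsetP eE; apply: EL.
  by rewrite eq mR' -(FE _ e m) // (eqP eq) fF.
rewrite /embeddings /= lin_extE.
under eq_bigr => g _ do rewrite [_ *: _]count.
rewrite exchange_big /= -sum1_card natr_sum; apply: eq_bigr => f fF.
have [e [m [eL mR fE]]] := imE f fF.
(* The sum runs over the support of [v] only; the class of the image of [f] belongs to it because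
   [e] lies in [E]. *)
have gv : im f \in msupp v.
  rewrite -mcoeff_neq0 vE mulf_neq0 ?invr_neq0 ?Aut_neq0 //.
  rewrite Num.Theory.pnatr_eq0 -lt0n; apply/card_gt0P; exists e.
  by rewrite -(FE _ _ m) // -fE.
rewrite (bigD1_seq (im f)) ?fset_uniq //= eqxx big1 ?addr0 // => g.
by rewrite eq_sym => /negbTE ->.
Qed.

(** The matrix of embedding counts is triangular for [mono_size] with nonzero diagonal: testing on
    [rep g] isolates the coefficient of [g] once those of smaller graphs vanish. *)
Lemma embeddings_separate v w : (forall u, embeddings u v = embeddings u w) -> v = w.
Proof.
move=> vw; apply/eqP; rewrite -subr_eq0; apply/eqP.
have {vw}z0 u : embeddings u (v - w) = 0 by rewrite linearB /= vw subrr.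
move: (v - w) z0 => {v w} z z0; apply/malgP => g; rewrite mcoeff0.
have [n] := ubnP (mono_size (rep g)); elim: n g => // n IH g gn.
have := z0 (rep g); rewrite /embeddings /= (lin_ext_mcoeff (k := g)) => [/eqP|j zj jg].
  rewrite mulf_eq0 Num.Theory.pnatr_eq0 => /orP[/eqP//|]; rewrite cards_eq0.
  case/set0Pn; exists [ffun x => x].
  by apply: subsetP (id_Iso (rep g)); apply: (fact_Iso_mono LR).
have [->//|/set0Pn[f fR]] := eqVneq (R (rep j) (rep g)) set0; first by rewrite cards0.
have fM := subsetP (fact_Mono LR _ _) _ fR.
have [/(Mono_eq_size fM)|lt] := leqP (mono_size (rep g)) (mono_size (rep j)).
  by rewrite -class_eqE class_rep (negbTE jg).
by case/eqP: zj; apply: IH; apply: leq_trans lt _.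
Qed.
End Factorization.

(** * Products and pairs of embeddings *)

Section Restrictions.
Variables (a b u : sgraph).
Implicit Types f : {ffun disjoint_union a b -> u}.

Lemma card_restrictions (A : {set {ffun a -> u}}) (B : {set {ffun b -> u}}) :
  #|[set f | (restrl f \in A) && (restrr f \in B)]| = (#|A| * #|B|)%N.
Proof.
rewrite -cardsX -(card_imset (f := fun f => (restrl f, restrr f))).
  apply: eq_card => -[g h]; rewrite in_setX; apply/imsetP/andP => [[f]|[gA hB]].
    by rewrite inE => /andP[? ?] [-> ->].
  pose f : {ffun disjoint_union a b -> u} :=
    [ffun x : a + b => match x with inl x => g x | inr x => h x end].
  have fl : restrl f = g by apply/ffunP => x; rewrite !ffunE.
  have fr : restrr f = h by apply/ffunP => x; rewrite !ffunE.
  by exists f; rewrite ?inE ?fl ?fr // gA.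
move=> f g [/ffunP l /ffunP r]; apply/ffunP => -[x|x].
  by have := l x; rewrite !ffunE.
by have := r x; rewrite !ffunE.
Qed.

Lemma Hom_restr f : (f \in Hom (disjoint_union a b) u) =
  (restrl f \in Hom a u) && (restrr f \in Hom b u).
Proof.
apply/HomP/andP => [fh|[/HomP lh /HomP rh] [x|x] [y|y] //].
- by split; apply/HomP => x y xy; rewrite !ffunE; apply: fh.
- by move/(lh x y); rewrite !ffunE.
- by move/(rh x y); rewrite !ffunE.
Qed.
End Restrictions.

Lemma restrl_comp (a b t u : sgraph) (m : {ffun t -> u})
    (e : {ffun disjoint_union a b -> t}) :
  restrl (comp_ffun m e) = comp_ffun m (restrl e).
Proof. by apply/ffunP => x; rewrite !ffunE. Qed.

Lemma restrr_comp (a b t u : sgraph) (m : {ffun t -> u})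
    (e : {ffun disjoint_union a b -> t}) :
  restrr (comp_ffun m e) = comp_ffun m (restrr e).
Proof. by apply/ffunP => x; rewrite !ffunE. Qed.

(** A pair of monomorphisms into [u] is one map out of the disjoint union. Both restrictions of the
    map are mono exactly when those of its regular epimorphic factor are, and [Mcount] counts such
    factors. *)
Lemma embeddings_mul_mono u a b :
  embeddings Mono u (mul_mono (gen ((a, b) : graph ** graph))) =
  (embeddings Mono u (gen a) : rat) * embeddings Mono u (gen b).
Proof.
rewrite !embeddings_gen -natrM -card_restrictions.
apply: (embeddings_factor RegEpi_Mono_system (s := disjoint_union (rep a) (rep b))
  (E := fun t => [set f in RegEpi (disjoint_union (rep a) (rep b)) t |
       (restrl f \in Mono (rep a) t) && (restrr f \in Mono (rep b) t)])).
- apply/subsetP => f; rewrite in_set => /andP[/MonoP[lh _] /MonoP[rh _]].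
  by rewrite Hom_restr lh.
- by move=> t; apply/subsetP => f; rewrite in_set => /andP[].
- move=> t e m eE mM; rewrite [LHS]in_set [RHS]in_set eE restrl_comp restrr_comp.
  have /EpiP[+ _] := subsetP (RegEpi_sub_Epi _ _) _ eE.
  by rewrite Hom_restr => /andP[lh rh]; rewrite !Mono_comp.
- exact: mul_monoE.
Qed.

Lemma embeddings_mul_regmono u a b :
  embeddings RegMono u (mul_regmono (gen ((a, b) : graph ** graph))) =
  (embeddings RegMono u (gen a) : rat) * embeddings RegMono u (gen b).
Proof.
rewrite !embeddings_gen -natrM -card_restrictions.
apply: (embeddings_factor Epi_RegMono_system (s := disjoint_union (rep a) (rep b))
  (E := fun t => [set f in Epi (disjoint_union (rep a) (rep b)) t |
       (restrl f \in RegMono (rep a) t) && (restrr f \in RegMono (rep b) t)])).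
- apply/subsetP => f; rewrite in_set => /andP[].
  move=> /(subsetP (RegMono_sub_Mono _ _))/MonoP[lh _].
  move=> /(subsetP (RegMono_sub_Mono _ _))/MonoP[rh _].
  by rewrite Hom_restr lh.
- by move=> t; apply/subsetP => f; rewrite in_set => /andP[].
- move=> t e m eE mM; rewrite [LHS]in_set [RHS]in_set eE restrl_comp restrr_comp.
  by rewrite !RegMono_comp.
- exact: mul_regmonoE.
Qed.

(** * Isomorphisms out of the algebra of disjoint unions *)

Section PhiHom.
Variables (L R : morphism_class) (mul : {linear QGG -> QG}) (Phi : {linear QG -> QG}).
Hypothesis LR : factorization_system L R.
Hypothesis L_glue : forall (s a b : sgraph) (A : {set s}) g h,
  (glue g h \in L s (disjoint_union a b)) =
  [&& edge_closed A, g \in L (induced A) a & h \in L (induced (~: A)) b].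
Hypothesis mulE : forall u a b,
  embeddings R u (mul (gen ((a, b) : graph ** graph))) =
  (embeddings R u (gen a) : rat) * embeddings R u (gen b).
Hypothesis PhiE : forall t s,
  (Phi (gen t))@_s = #|L (rep t) (rep s)|%:R / #|Aut (rep s)|%:R.

(** The central count with [F] the set of all homomorphisms, so that every first factor in [L]
    qualifies. *)
Lemma embeddings_Phi u t : embeddings R u (Phi (gen t)) = #|Hom (rep t) u|%:R.
Proof.
apply: (embeddings_factor LR (E := L (rep t))) => // s e m eL mR.
have /EpiP[eh _] := subsetP (fact_Epi LR _ _) _ eL.
have /MonoP[mh _] := subsetP (fact_Mono LR _ _) _ mR.
by rewrite eL Hom_comp.
Qed.

Lemma card_L_iso s s' t t' : isomorphic s s' -> isomorphic t t' -> #|L s t| = #|L s' t'|.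
Proof.
apply: card_iso_invariant => a b c g f => [/(subsetP (fact_Iso_epi LR _ _))|].
  exact: (fact_comp_epi LR).
by move=> /(subsetP (fact_Iso_epi LR _ _)) fL gL; apply: (fact_comp_epi LR).
Qed.

(** Tested against [embeddings R u], both sides count homomorphisms from the disjoint union to
    [u]. *)
Lemma Phi_mul a b : Phi (mul_hom (tensor a b)) = mul (tensor (Phi a) (Phi b)).
Proof.
have mulE' u v w : embeddings R u (mul (tensor v w)) =
    (embeddings R u v : rat) * embeddings R u w.
  elim/free_ind: v => [|c v v' IH IH'|k].
  - by rewrite tensor0l !linear0 mul0r.
  - by rewrite tensorDl !linearP /= IH IH' mulrDl -mulrA.
  elim/free_ind: w => [|c w w' IH IH'|l].
  - by rewrite tensor0r !linear0 mulr0.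
  - by rewrite tensorDr !linearP /= IH IH' mulrDr mulrCA.
  by rewrite tensorU mulE.
elim/free_ind: a => [|c v v' IH IH'|k].
- by rewrite !(tensor0l, linear0).
- by rewrite tensorDl !linearP /= tensorDl linearP IH IH'.
elim/free_ind: b => [|c w w' IH IH'|l].
- by rewrite !(tensor0r, linear0).
- by rewrite tensorDr !linearP /= IH IH'.
apply: (embeddings_separate LR) => u; rewrite mulE' tensorU mul_homU !embeddings_Phi.
rewrite -natrM -card_restrictions; congr _%:R.
have -> : #|Hom (rep (gunion k l)) u| = #|Hom (disjoint_union (rep k) (rep l)) u|.
  apply: (card_iso_invariant (X := Hom)) => [s t w g f gI fH|s t w g f fI gH||].
  - by have /EpiP[gH _] := subsetP (Iso_sub_Epi _ _) _ gI; apply: Hom_comp.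
  - by have /EpiP[fH _] := subsetP (Iso_sub_Epi _ _) _ fI; apply: Hom_comp.
  - exact: rep_class.
  - exact: isomorphic_refl.
by apply: eq_card => f; rewrite [RHS]in_set Hom_restr.
Qed.

(** At [(a, b)] the left side is the number of [L]-maps from [t] to the union, divided by the
    automorphisms of [a] and [b]. Sorting these maps by the preimage of [a] gives the splittings of
    [t] on the right. *)
Lemma Phi_comul a : comul_hom' (Phi a) = tensor_map Phi Phi (comul_hom' a).
Proof.
elim/free_ind: a => [|c v w IH IH'|t]; first by rewrite !linear0.
  by rewrite !linearP /= IH IH'.
apply/malgP => -[a b]; rewrite mcoeff_comul_hom'_lin PhiE.
rewrite mulrA divfK ?Aut_neq0 //.
rewrite (card_L_iso (isomorphic_refl _) (rep_class _)) (card_glue (X := L)) //.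
rewrite -[t in RHS]class_rep comul_hom'_closed.
rewrite [comul_closed _]/comul_closed natr_sum mulr_suml linear_sum raddf_sum /=.
apply: eq_bigr => A _; rewrite [tensor_map _ _ _]lin_extU mcoeff_tensor !PhiE.
rewrite !(card_L_iso (rep_class _) (isomorphic_refl _)) natrM invfM.
by rewrite mulrACA.
Qed.

Lemma L_coef_neq0 k j : (Phi (gen k))@_j != 0 -> exists f, f \in L (rep k) (rep j).
Proof.
rewrite PhiE => k0; apply/set0Pn; apply: contraNneq k0 => ->.
by rewrite cards0 mul0r.
Qed.

Lemma Phi_bijective : bijective Phi.
Proof.
have := @triangular_bijective _ (fun g : graph => #|non_edges (rep g)|) (fun g => Phi (gen g)).
case=> [k|k j /L_coef_neq0[f fL] jk|g gK Kg].
- rewrite PhiE mulf_neq0 ?invr_neq0 ?Aut_neq0 //.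
  rewrite Num.Theory.pnatr_eq0 cards_eq0; apply/set0Pn; exists [ffun x => x].
  by apply: (subsetP (fact_Iso_epi LR _ _)); apply: id_Iso.
- have fE := subsetP (fact_Epi LR _ _) _ fL; rewrite ltnNge; apply/negP.
  move=> /(Epi_eq_non_edges fE); rewrite isomorphic_sym -class_eqE class_rep.
  by rewrite (negbTE jk).
by exists g => v; rewrite -?(lin_ext_gen Phi).
Qed.

Lemma Phi_hom_isomorphism : is_hopf_isomorphism (graph_hopf mul_hom comul_hom')
  (graph_hopf mul comul_hom') Phi.
Proof.
have e0 : #|rep empty_graph| = 0%N by apply/eqP; rewrite card_eq_empty.
(* Only the empty graph admits a map to the empty graph; this gives compatibility with the
   counit. *)
have Phi_coef0 t : (Phi (gen t))@_empty_graph = (t == empty_graph)%:R.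
  have [->|te] := eqVneq t empty_graph; last first.
    apply/eqP; apply: contraNT te => /L_coef_neq0[f _].
    rewrite -card_eq_empty; apply/pred0P => x.
    by have := fintype0 (f x) e0.
  rewrite PhiE card_Aut_empty divr1; congr _%:R; apply/eqP; rewrite eqn_leq.
  apply/andP; split.
    by apply: leq_trans (max_card _) _; rewrite card_ffun !e0.
  apply/card_gt0P; exists [ffun x => x].
  by apply: (subsetP (fact_Iso_epi LR _ _)); apply: id_Iso.
have Phi1 : Phi unit_graph = unit_graph.
  apply/malgP => s; rewrite genE; have [<-|se] := eqVneq empty_graph s.
    by rewrite Phi_coef0 eqxx.
  apply/eqP; apply: contraNT se => /L_coef_neq0[f fL].
  rewrite eq_sym -card_eq_empty -leqn0 -e0.
  exact: Epi_card (subsetP (fact_Epi LR _ _) _ fL).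
apply: hopf_transport hom_hopf => //.
- exact: Phi_mul.
- exact: Phi_comul.
- move=> a; rewrite [LHS]counit_graphE [RHS]counit_graphE.
  elim/free_ind: a => [|c v w IH IH'|t]; first by rewrite linear0.
    by rewrite linearP !mcoeffD !mcoeffZ IH IH'.
  by rewrite Phi_coef0 genE.
- exact: Phi_bijective.
Qed.
End PhiHom.

Lemma mono_isomorphism : is_hopf_isomorphism (graph_hopf mul_hom comul_hom')
  (graph_hopf mul_mono comul_hom') Phi_mono_hom.
Proof.
apply: (Phi_hom_isomorphism RegEpi_Mono_system).
- exact: glue_RegEpi.
- exact: embeddings_mul_mono.
- exact: Phi_mono_homE.
Qed.

Lemma regmono_isomorphism : is_hopf_isomorphism (graph_hopf mul_hom comul_hom')
  (graph_hopf mul_regmono comul_hom') Phi_regmono_hom.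
Proof.
apply: (Phi_hom_isomorphism Epi_RegMono_system).
- exact: glue_Epi.
- exact: embeddings_mul_regmono.
- exact: Phi_regmono_homE.
Qed.

(** A monomorphism factors as a vertex-bijective one followed by a regular one, so
    [Phi_regmono_mono] turns counts of regular monomorphisms into counts of monomorphisms. Both
    sides then count all homomorphisms into [u]. *)
Lemma Phi_regmono_hom_comp a : Phi_regmono_hom a = Phi_regmono_mono (Phi_mono_hom a).
Proof.
apply: (embeddings_separate Epi_RegMono_system) => u.
have rm_m v : embeddings RegMono u (Phi_regmono_mono v) = embeddings Mono u v.
  elim/free_ind: v => [|c v w IH IH'|t].
  - by rewrite !linear0.
  - by rewrite !linearP /= IH IH'.
  rewrite embeddings_gen; apply: (embeddings_factor Epi_RegMono_system
    (E := fun s => Mono (rep t) s :&: Epi (rep t) s)).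
  - by apply/subsetP => f /MonoP[].
  - by move=> s; apply: subsetIr.
  - move=> s e m eE mR; rewrite in_setI eE andbT Mono_comp //.
      exact: subsetP (RegMono_sub_Mono _ _) _ mR.
    by case/EpiP: eE.
  - exact: Phi_regmono_monoE.
elim/free_ind: a => [|c v w IH IH'|t].
- by rewrite !linear0.
- by rewrite !linearP /= IH IH'.
rewrite rm_m (embeddings_Phi Epi_RegMono_system Phi_regmono_homE).
by rewrite (embeddings_Phi RegEpi_Mono_system Phi_mono_homE).
Qed.

(** * Rescaling the basis by automorphisms *)

Lemma Phi_aut_bijective : bijective Phi_aut.
Proof.
pose g : {linear QG -> QG} := lin_ext (fun t : graph => (#|Aut (rep t)|%:R)^-1 *: gen t).
exists g => u; elim/free_ind: u => [|c v w IH IH'|t].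
- by rewrite !linear0.
- by rewrite !linearP /= IH IH'.
- by rewrite /Phi_aut /g /= lin_extU linearZ /= lin_extU scalerA mulfV ?scale1r ?Aut_neq0.
- by rewrite !linear0.
- by rewrite !linearP /= IH IH'.
- by rewrite /Phi_aut /g /= lin_extU linearZ /= lin_extU scalerA mulVf ?scale1r ?Aut_neq0.
Qed.

Lemma mcoeff_Phi_aut u g : (Phi_aut u)@_g = u@_g * #|Aut (rep g)|%:R.
Proof.
elim/free_ind: u => [|c v w IH IH'|t].
- by rewrite linear0 !mcoeff0 mul0r.
- by rewrite linearP !mcoeffD !mcoeffZ IH IH' mulrDl mulrA.
rewrite /Phi_aut /= lin_extU mcoeffZ genE mulrC.
by case: eqP => [->|_]; rewrite ?mul0r ?mul1r.
Qed.

(** The hypothesis says that rescaling conjugates [mul] into [mul']. For the coproducts, the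
    automorphism quotient in [mcoeff_comul_hom'] is exactly what the rescaling absorbs, leaving the
    0-1 coefficients of [comul_hom]. *)
Lemma Phi_aut_isomorphism (mul mul' : {linear QGG -> QG}) :
  (forall a b g, (mul' (gen ((a, b) : graph ** graph)))@_g *
      (#|Aut (rep a)|%:R * #|Aut (rep b)|%:R) =
    (mul (gen ((a, b) : graph ** graph)))@_g * #|Aut (rep g)|%:R) ->
  is_hopf_algebra (graph_hopf mul comul_hom') ->
  is_hopf_isomorphism (graph_hopf mul comul_hom') (graph_hopf mul' comul_hom) Phi_aut.
Proof.
move=> mulE A.
have Phi_gen t : Phi_aut (gen t) = #|Aut (rep t)|%:R *: gen t by rewrite /Phi_aut /= lin_extU.
apply: hopf_transport A; last exact: Phi_aut_bijective.
- move=> a b /=; elim/free_ind: a => [|c v v' IH IH'|k].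
  + by rewrite !(tensor0l, linear0).
  + by rewrite tensorDl !linearP /= tensorDl linearP IH IH'.
  elim/free_ind: b => [|c w w' IH IH'|l].
  + by rewrite !(tensor0r, linear0).
  + by rewrite tensorDr !linearP /= IH IH'.
  apply/malgP => g; rewrite !Phi_gen tensorZl tensorZr !linearZ /= tensorU.
  by rewrite mcoeff_Phi_aut !mcoeffZ -mulE; ring.
- by rewrite /= Phi_gen card_Aut_empty scale1r.
- move=> a; rewrite -[hcomul _ in LHS]/comul_hom -[hcomul _ in RHS]/comul_hom'.
  elim/free_ind: a => [|c v w IH IH'|t]; first by rewrite !linear0.
    by rewrite !linearP /= IH IH'.
  apply/malgP => -[a b]; rewrite Phi_gen linearZ /= mcoeffZ comul_homE /=.
  rewrite /tensor_map mcoeff_lin_ext (lin_ext_mcoeff (k := ((a, b) : graph ** graph))).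
    rewrite mcoeff_tensor !mcoeff_Phi_aut !genE !eqxx mcoeff_comul_hom' !mul1r.
    by field; rewrite !Aut_neq0.
  case=> a' b' _ /=; rewrite xpair_eqE negb_and mcoeff_tensor !mcoeff_Phi_aut !genE.
  by case/orP=> /negbTE ->; rewrite !(mul0r, mulr0).
- by move=> a; rewrite [LHS]counit_graphE [RHS]counit_graphE mcoeff_Phi_aut card_Aut_empty mulr1.
Qed.

Theorem theorem3p29 :
  is_hopf_isomorphism (graph_hopf mul_mono comul_hom')
    (graph_hopf mul_regmono comul_hom') Phi_regmono_mono /\
  is_hopf_isomorphism (graph_hopf mul_hom comul_hom')
    (graph_hopf mul_mono comul_hom') Phi_mono_hom /\
  is_hopf_isomorphism (graph_hopf mul_hom comul_hom')
    (graph_hopf mul_regmono comul_hom') Phi_regmono_hom /\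
  is_hopf_isomorphism (graph_hopf mul_hom comul_hom')
    (graph_hopf mul_hom' comul_hom) Phi_hom'_hom /\
  is_hopf_isomorphism (graph_hopf mul_mono comul_hom')
    (graph_hopf mul_mono' comul_hom) Phi_mono'_mono /\
  is_hopf_isomorphism (graph_hopf mul_regmono comul_hom')
    (graph_hopf mul_regmono' comul_hom) Phi_regmono'_regmono.
Proof.
have Mi := mono_isomorphism.
have Ri := regmono_isomorphism.
have [_ [MH _]] := Mi.
have [_ [RH _]] := Ri.
(* The first map is the third side of the triangle formed with the two maps out of [mul_hom]. *)
split; first exact: hopf_transport_cancel Phi_regmono_hom_comp Mi Ri.
split=> //; split=> //; split; [|split]; apply: Phi_aut_isomorphism => //.
(* The dual product has the transposed coefficients of [comul_hom'], so its automorphism quotient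
   supplies the rescaling. *)
- move=> a b g; rewrite mul_hom'E mcoeff_comul_hom' mul_homU genE [_ * (_ / _)]mulrA divfK //.
  by rewrite mulf_neq0 ?Aut_neq0.
- exact: hom_hopf.
(* Both products share the numerator [Mcount] and differ only in the denominators. *)
- by move=> a b g; rewrite mul_mono'E mul_monoE !divfK ?mulf_neq0 ?Aut_neq0.
- by move=> a b g; rewrite mul_regmono'E mul_regmonoE !divfK ?mulf_neq0 ?Aut_neq0.
Qed.
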